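(* Multistage 2-SAT is solvable in $O(n^{2\tau\cdot d}\cdot 2^{\tau\cdot d+1}\cdot\tau\cdot(n+m))$ time.
   Context: A 2-CNF formula is a conjunction of clauses, each a disjunction of at most two literals (variables or negated variables). Multistage 2-SAT: the input is a set $X$ of variables, a sequence $\Phi=(\phi_1,\dots,\phi_\tau)$, $\tau\ge 1$, of 2-CNF formulas (the ''stages'') over literals over $X$, and an integer $d\ge 0$. The question is whether there are $\tau$ truth assignments $f_1,\dots,f_\tau\colon X\to\{\bot,\top\}$ such that (i) for each $i\in\{1,\dots,\tau\}$, $f_i$ satisfies $\phi_i$, and (ii) for each $i\in\{1,\dots,\tau-1\}$, $|\{x\in X\mid f_i(x)\ne f_{i+1}(x)\}|\le d$. Here $n=|X|$ is the number of variables and $m$ is the maximum number of clauses in any stage. *)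

(* Defs.v *)
From mathcomp Require Import all_boot.

Set Implicit Arguments.
Unset Strict Implicit.
Unset Printing Implicit Defensive.

(** * Multistage 2-SAT *)

(* The literal (x, true) is x and (x, false) is its negation. *)
Definition literal (n : nat) : Type := 'I_n * bool.
Definition clause (n : nat) : Type := 2.-bseq (literal n).
Definition cnf2 (n : nat) : Type := seq (clause n).
Definition assignment (n : nat) : Type := {ffun 'I_n -> bool}.

Definition sat_literal n (f : assignment n) (l : literal n) : bool :=
  f l.1 == l.2.
Definition sat_clause n (f : assignment n) (c : clause n) : bool :=
  has (sat_literal f) c.
Definition sat_cnf n (f : assignment n) (phi : cnf2 n) : bool :=
  all (sat_clause f) phi.

Record ms2sat_input : Type := Ms2satInput {
  nvars : nat;
  nstages : nat;
  nstages_gt0 : 0 < nstages;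
  stage : nstages.-tuple (cnf2 nvars);
  maxchange : nat
}.

Definition multistage_2sat (I : ms2sat_input) : Prop :=
  exists f : 'I_(nstages I) -> assignment (nvars I),
    (forall i, sat_cnf (f i) (tnth (stage I) i)) /\
    (forall i j : 'I_(nstages I), j = i.+1 :> nat ->
       #|[set x | f i x != f j x]| <= maxchange I).

Definition max_clauses (I : ms2sat_input) : nat :=
  \max_(i < nstages I) size (tnth (stage I) i).

(** * Random access machines with unit cost *)

(* The instruction set is that of the random access machine of Cook and
   Reckhow (addition and truncated subtraction, indirect load and store, but no
   multiplication), with structured control flow in place of jumps, which
   changes running times by at most a constant factor.  A program mentions only
   finitely many registers; unbounded storage is provided by the memory. *)
Inductive cmd : Type :=
| Skip
| Const (r : nat) (k : nat)      (* r := k *)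
| Add (r a b : nat)              (* r := a + b *)
| Sub (r a b : nat)              (* r := a - b *)
| Read (r a : nat)               (* r := mem[a] *)
| Write (a b : nat)              (* mem[a] := b *)
| Seq (c1 c2 : cmd)
| If (r : nat) (c1 c2 : cmd)     (* c1 if r is nonzero, else c2 *)
| While (r : nat) (c : cmd).     (* repeat c as long as r is nonzero *)

Record state : Type := State { reg : nat -> nat; mem : nat -> nat }.

Definition upd (m : nat -> nat) (a v : nat) : nat -> nat :=
  fun b => if b == a then v else m b.

Definition set_reg (s : state) (r v : nat) : state :=
  State (upd (reg s) r v) (mem s).
Definition set_mem (s : state) (a v : nat) : state :=
  State (reg s) (upd (mem s) a v).

(* [exec c s t s']: started in state s, c halts after t steps in state s'. *)
Inductive exec : cmd -> state -> nat -> state -> Prop :=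
| ExecSkip s : exec Skip s 1 s
| ExecConst r k s : exec (Const r k) s 1 (set_reg s r k)
| ExecAdd r a b s : exec (Add r a b) s 1 (set_reg s r (reg s a + reg s b))
| ExecSub r a b s : exec (Sub r a b) s 1 (set_reg s r (reg s a - reg s b))
| ExecRead r a s : exec (Read r a) s 1 (set_reg s r (mem s (reg s a)))
| ExecWrite a b s : exec (Write a b) s 1 (set_mem s (reg s a) (reg s b))
| ExecSeq c1 c2 s1 s2 s3 t1 t2 :
    exec c1 s1 t1 s2 -> exec c2 s2 t2 s3 -> exec (Seq c1 c2) s1 (t1 + t2) s3
| ExecIfTrue r c1 c2 s s' t :
    reg s r != 0 -> exec c1 s t s' -> exec (If r c1 c2) s t.+1 s'
| ExecIfFalse r c1 c2 s s' t :
    reg s r = 0 -> exec c2 s t s' -> exec (If r c1 c2) s t.+1 s'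
| ExecWhileFalse r c s :
    reg s r = 0 -> exec (While r c) s 1 s
| ExecWhileTrue r c s1 s2 s3 t1 t2 :
    reg s1 r != 0 -> exec c s1 t1 s2 -> exec (While r c) s2 t2 s3 ->
    exec (While r c) s1 (t1 + t2).+1 s3.

(* The input word occupies the first memory cells; all else is zero. *)
Definition init_state (w : seq nat) : state :=
  State (fun=> 0) (fun a => nth 0 w a).

(* The answer is read off register 0. *)
Definition accepting (s : state) : Prop := reg s 0 != 0.

(* The problem Q, with inputs encoded by enc, is solvable in O(f) time.  The
   constant is uniform in all parameters of the input.  As every computation
   takes at least one step, the time bound is only required where f is nonzero;
   the program has to halt with the right answer on every input. *)
Definition solvable_in_bigO (T : Type) (enc : T -> seq nat) (Q : T -> Prop)
    (f : T -> nat) : Prop :=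
  exists (p : cmd) (C : nat), forall x : T, exists (t : nat) (s : state),
    [/\ exec p (init_state (enc x)) t s,
        accepting s <-> Q x
      & 0 < f x -> t <= C * f x].

(** * Input encoding *)

(* A list is stored as its length followed by its items; a literal takes two
   cells (index of the variable, sign) and a number takes one cell. *)
Definition encode_list (T : Type) (enc : T -> seq nat) (s : seq T) : seq nat :=
  size s :: flatten (map enc s).

Definition encode_literal n (l : literal n) : seq nat :=
  [:: nat_of_ord l.1; nat_of_bool l.2].
Definition encode_clause n (c : clause n) : seq nat :=
  encode_list (@encode_literal n) c.
Definition encode_cnf n (phi : cnf2 n) : seq nat :=
  encode_list (@encode_clause n) phi.

Definition encode_ms2sat (I : ms2sat_input) : seq nat :=
  [:: nvars I, maxchange I & encode_list (@encode_cnf (nvars I)) (stage I)].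

(* Main.v *)
(** Change sets are enumerated: after replacing d by min(d, n), a vector of
    tau * d digits in 0, ..., n (0 means "no variable") lists the variables that
    are flipped before each stage.  There are (n+1)^(tau d) <= n^(tau d) 2^(tau d)
    vectors if n > 0.  For a fixed vector every f_i is a known flip of a single
    unknown assignment, so all stages together form one 2-CNF formula with at
    most tau m clauses, and it remains to solve 2-SAT in linear time.

    The 2-SAT solver (after del Val) is a single depth-first search of the
    implication graph that tentatively makes visited literals true.  When an arc
    v -> y is scanned with neg y already visited, neg y is still on the stack:
    otherwise its arc to neg v would have been scanned.  Hence neg y -> ... -> v -> y
    and y is entailed.  Afterwards the entailed literals are closed under
    implication; the formula is satisfiable iff this set is consistent, a model
    being given by the entailed literals and, elsewhere, by the tentative ones. *)

(* Truncating d to min(d, n) is essential: every vector is read digit by digit, and for n = 1 the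
   bound has no slack that could absorb a factor d. A flip acts on literals rather than on values:
   in each stage a variable stands for a literal over the unknown assignment, and flipping it
   negates that literal. The obstacle is that everything done for one vector has to be linear on a
   machine that cannot multiply: the graph is rebuilt and the marks are cleared each time, adjacency
   lists are consumed rather than copied, and the closure gets a second set of list heads because
   the search uses up the first. Empty clauses, which no arc can express, are reported by a flag.
   Time is amortised: loop invariants tie the remaining credits to a potential, and every iteration
   releases enough of it to pay for itself. *)
From Stdlib Require Import FunctionalExtensionality Classical.
From mathcomp Require Import all_boot.
From mathcomp Require Import zify.
Require Import Defs.

Set Implicit Arguments.
Unset Strict Implicit.
Unset Printing Implicit Defensive.

(** * Weakest preconditions with time credits *)

(* Started in s with k time credits, c halts in a state satisfying Q, where Q
   also receives the number of credits that are left. *)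
Definition wp (c : cmd) (Q : state -> nat -> Prop) (s : state) (k : nat) : Prop :=
  exists t s', [/\ exec c s t s', t <= k & Q s' (k - t)].

Notation "c1 ;; c2" := (Seq c1 c2) (at level 60, right associativity).

(* Register 20 is a scratch register. *)
Definition Fetch r b i := Add 20 b i ;; Read r 20.
Definition Store b i v := Add 20 b i ;; Write 20 v.

(** Register numbers are numerals and the test is [eqn], so that [lazy] evaluates lookups during
    symbolic execution; [set] overwrites in place, which keeps the list short. *)
Fixpoint get (f : nat -> nat) (al : seq (nat * nat)) : nat -> nat :=
  if al is (a, v) :: al' then fun r => if eqn r a then v else get f al' r else f.

Fixpoint set (al : seq (nat * nat)) (r v : nat) : seq (nat * nat) :=
  if al is (a, w) :: al' then
    if eqn r a then (a, v) :: al' else (a, w) :: set al' r v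
  else [:: (r, v)].

(* The state s with its registers updated by the association list al and with
   memory m; this is the normal form of states in symbolic execution. *)
Definition over (s : state) (al : seq (nat * nat)) (m : nat -> nat) : state :=
  State (get (reg s) al) m.

Lemma get_set f al r v r' : get f (set al r v) r' = if r' == r then v else get f al r'.
Proof.
elim: al => [|[a w] al IH] //=; rewrite -!/(_ == _).
have [->|ra] := eqVneq r a; first by rewrite /= -/(_ == _); case: eqP.
by rewrite /= -/(_ == _) IH; have [->|] := eqVneq r' a; rewrite // eq_sym (negbTE ra).
Qed.

Lemma over_nil s : s = over s [::] (mem s). Proof. by case: s. Qed.

Lemma over_set s al m r v : set_reg (over s al m) r v = over s (set al r v) m.
Proof.
rewrite /over /set_reg /=; congr State.
by apply: functional_extensionality => r'; rewrite get_set.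
Qed.

Lemma over_ext s al al' m :
  (forall r, get (reg s) al r = get (reg s) al' r) -> over s al m = over s al' m.
Proof. by move=> h; congr State; apply: functional_extensionality. Qed.

(* Credits are kept in the form c + k with c a numeral, so that each command
   takes its cost off c by unification. *)
Lemma wp_skip (Q : state -> nat -> Prop) s c k :
  Q s (c + k) -> wp Skip Q s (c.+1 + k).
Proof. by move=> q; exists 1, s; split => //; [constructor | rewrite addSn subn1]. Qed.

Lemma wp_const r v (Q : state -> nat -> Prop) s al m c k :
  Q (over s (set al r v) m) (c + k) -> wp (Const r v) Q (over s al m) (c.+1 + k).
Proof.
by rewrite -over_set => q; eexists 1, _; split=> //; [constructor | rewrite addSn subn1].
Qed.

Lemma wp_add r a b (Q : state -> nat -> Prop) s al m c k :
  Q (over s (set al r (get (reg s) al a + get (reg s) al b)) m) (c + k) ->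
  wp (Add r a b) Q (over s al m) (c.+1 + k).
Proof.
by rewrite -over_set => q; eexists 1, _; split=> //; [constructor | rewrite addSn subn1].
Qed.

Lemma wp_sub r a b (Q : state -> nat -> Prop) s al m c k :
  Q (over s (set al r (get (reg s) al a - get (reg s) al b)) m) (c + k) ->
  wp (Sub r a b) Q (over s al m) (c.+1 + k).
Proof.
by rewrite -over_set => q; eexists 1, _; split=> //; [constructor | rewrite addSn subn1].
Qed.

Lemma wp_read r a (Q : state -> nat -> Prop) s al m c k :
  Q (over s (set al r (m (get (reg s) al a))) m) (c + k) ->
  wp (Read r a) Q (over s al m) (c.+1 + k).
Proof.
by rewrite -over_set => q; eexists 1, _; split=> //; [constructor | rewrite addSn subn1].
Qed.

Lemma wp_write a b (Q : state -> nat -> Prop) s al m c k :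
  Q (over s al (upd m (get (reg s) al a) (get (reg s) al b))) (c + k) ->
  wp (Write a b) Q (over s al m) (c.+1 + k).
Proof. by move=> q; eexists 1, _; split=> //; [constructor | rewrite addSn subn1]. Qed.

Lemma wp_seq c1 c2 (Q : state -> nat -> Prop) s k :
  wp c1 (wp c2 Q) s k -> wp (Seq c1 c2) Q s k.
Proof.
move=> [t1 [s1 [e1 k1 [t2 [s2 [e2 k2 q]]]]]].
exists (t1 + t2), s2; split; [exact: ExecSeq e1 e2 | lia | by rewrite subnDA].
Qed.

Lemma wp_if r c1 c2 (Q : state -> nat -> Prop) s al m c k :
  (get (reg s) al r <> 0 -> wp c1 Q (over s al m) (c + k)) ->
  (get (reg s) al r = 0 -> wp c2 Q (over s al m) (c + k)) ->
  wp (If r c1 c2) Q (over s al m) (c.+1 + k).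
Proof.
rewrite addSn => h1 h2; have [e|/eqP e] := reg (over s al m) r =P 0.
  have [t [s' [ex tk q]]] := h2 e; exists t.+1, s'; split=> //; exact: ExecIfFalse.
have [t [s' [ex tk q]]] := h1 (elimN eqP e); exists t.+1, s'; split => //.
exact: ExecIfTrue.
Qed.

(* Every iteration uses up a credit, so the loop terminates. *)
Lemma wp_while r c (I Q : state -> nat -> Prop) s k :
  I s k ->
  (forall s k, I s k -> 0 < k /\
     (reg s r = 0 -> Q s (k - 1)) /\ (reg s r <> 0 -> wp c I s (k - 1))) ->
  wp (While r c) Q s k.
Proof.
move=> + h; have [m] := ubnP k; elim: m s k => // m IH s k km i.
have [k0 [h1 h2]] := h _ _ i; have [e|/eqP e] := reg s r =P 0.
  by exists 1, s; split; [exact: ExecWhileFalse | | exact: h1].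
have [t [s' [ex tk i']]] := h2 (elimN eqP e).
have [t' [s'' [ex' tk' q]]] := IH s' _ (ltac:(lia) : k - 1 - t < m) i'.
exists (t + t').+1, s''; split; [exact: ExecWhileTrue ex ex' | lia |].
by have -> : k - (t + t').+1 = k - 1 - t - t' by lia.
Qed.

Lemma wp_fetch r b i (Q : state -> nat -> Prop) s al m c k :
  Q (over s (set (set al 20 (get (reg s) al b + get (reg s) al i)) r
              (m (get (reg s) al b + get (reg s) al i))) m) (c + k) ->
  wp (Fetch r b i) Q (over s al m) (c.+2 + k).
Proof.
by move=> q; apply: wp_seq; apply: wp_add; apply: wp_read; rewrite get_set eqxx.
Qed.

Lemma wp_store b i v (Q : state -> nat -> Prop) s al m c k :
  v != 20 ->
  Q (over s (set al 20 (get (reg s) al b + get (reg s) al i))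
       (upd m (get (reg s) al b + get (reg s) al i) (get (reg s) al v))) (c + k) ->
  wp (Store b i v) Q (over s al m) (c.+2 + k).
Proof.
move=> v20 q; apply: wp_seq; apply: wp_add; apply: wp_write.
by rewrite !get_set eqxx (negbTE v20).
Qed.

Lemma reg_over s al m r : reg (over s al m) r = get (reg s) al r.
Proof. by []. Qed.
Lemma mem_over s al m : mem (over s al m) = m.
Proof. by []. Qed.

Lemma wp_over c (Q : state -> nat -> Prop) s k :
  wp c Q (over s [::] (mem s)) k -> wp c Q s k.
Proof. by rewrite -over_nil. Qed.

Global Opaque over.

Ltac simp := rewrite ?(reg_over, mem_over); lazy [get set eqn].

Ltac start := apply: wp_over.

Ltac step :=
  lazymatch goal with
  | |- wp (Seq _ _) _ _ _ => apply: wp_seq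
  | |- wp (Fetch _ _ _) _ _ _ => apply: wp_fetch
  | |- wp (Store _ _ _) _ _ _ => apply: wp_store; [done|]
  | |- wp Skip _ _ _ => apply: wp_skip
  | |- wp (Const _ _) _ _ _ => apply: wp_const
  | |- wp (Add _ _ _) _ _ _ => apply: wp_add
  | |- wp (Sub _ _ _) _ _ _ => apply: wp_sub
  | |- wp (Read _ _) _ _ _ => apply: wp_read
  | |- wp (Write _ _) _ _ _ => apply: wp_write
  end; lazy [get set eqn].

(* Symbolic execution up to the next branching or loop, rewriting the values
   of registers with the equations E. *)
Ltac run E := repeat (step; rewrite ?E).

Ltac branch E := run E; apply: wp_if; lazy [get set eqn]; rewrite ?E.

(* lia is very slow in the presence of boolean hypotheses. *)
Ltac nlia :=
  repeat match goal with
  | H : ?P |- _ =>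
    lazymatch type of P with
    | Prop =>
      lazymatch P with
      | is_true (leq _ _) => fail
      | is_true (_ && _) => fail
      | @eq ?T _ _ => tryif unify T nat then fail else clear H
      | ~ (@eq ?T _ _) => tryif unify T nat then fail else clear H
      | _ => clear H
      end
    end
  end; lia.

(** * Point updates of functions and their effect on sums *)

Definition put (T : Type) (f : nat -> T) (a : nat) (v : T) : nat -> T :=
  fun b => if b == a then v else f b.

Lemma putE (T : Type) (f : nat -> T) a v : put f a v a = v.
Proof. by rewrite /put eqxx. Qed.

Lemma put_neq (T : Type) (f : nat -> T) a v b : b != a -> put f a v b = f b.
Proof. by rewrite /put => /negbTE ->. Qed.

(** The old and the new value are added on opposite sides, which avoids truncated subtraction in the
    potential arguments. *)
Lemma sum_put (T : Type) (F : T -> nat) (f : nat -> T) a v p q :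
  p <= a < q ->
  \sum_(p <= i < q) F (put f a v i) + F (f a) = \sum_(p <= i < q) F (f i) + F v.
Proof.
move=> /andP[pa aq].
rewrite (@big_cat_nat _ _ _ a p) ?(ltnW aq) //= (@big_cat_nat _ _ _ a p q) ?(ltnW aq) //=.
rewrite !(@big_ltn _ _ _ a) //= putE.
rewrite (@eq_big_nat _ _ _ p a _ (fun i => F (f i))); last first.
  by move=> i ip; rewrite put_neq //; lia.
rewrite (@eq_big_nat _ _ _ a.+1 q _ (fun i => F (f i))); last first.
  by move=> i ip; rewrite put_neq //; lia.
lia.
Qed.

(** * Literals and implication graphs *)

(* The literals over n variables are coded by 1, ..., 2n: the code of the i-th
   variable is i.+1 and the two literals of a variable add up to 2n+1.  The
   value 0 is left free to serve as a null pointer. *)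
Definition lit (n l : nat) : bool := 0 < l <= n.*2.
Definition neg (n l : nat) : nat := n.*2.+1 - l.

Definition ev (n : nat) (g : nat -> bool) (l : nat) : bool :=
  if l <= n then g l else ~~ g (neg n l).

Lemma lit_neg n l : lit n l -> lit n (neg n l).
Proof. rewrite /lit /neg; lia. Qed.

Lemma negK n l : lit n l -> neg n (neg n l) = l.
Proof. rewrite /lit /neg; lia. Qed.

Lemma ev_neg n g l : lit n l -> ev n g (neg n l) = ~~ ev n g l.
Proof.
move=> ll; rewrite /ev negK //; move: ll; rewrite /lit /neg => ll.
case: ifP => h1; case: ifP => h2 //; first lia.
- by rewrite negbK.
- lia.
Qed.

(** Closure under contraposition (skew-symmetry) is the property on which the depth-first search
    rests: an arc v -> y comes with neg y -> neg v. *)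
Definition impl_graph n (es : seq (nat * nat)) : Prop :=
  forall u v, (u, v) \in es -> [/\ lit n u, lit n v & (neg n v, neg n u) \in es].

Definition satg n (es : seq (nat * nat)) (g : nat -> bool) : Prop :=
  forall u v, (u, v) \in es -> ev n g u -> ev n g v.

Definition entailed n es l : Prop := forall g, satg n es g -> ev n g l.

(** The order of [es] is kept, so that consing an arc onto [es] amounts to prepending a node to one
    linked list. *)
Definition adj (es : seq (nat * nat)) (l : nat) : seq nat :=
  [seq e.2 | e <- es & e.1 == l].

Lemma mem_adj es u v : (v \in adj es u) = ((u, v) \in es).
Proof.
apply/mapP/idP => [[[a b]] | h]; last by exists (u, v) => //; rewrite mem_filter eqxx.
by rewrite mem_filter /= => /andP[/eqP -> ab] ->.
Qed.

Definition cnt n (T : nat -> bool) : nat := \sum_(1 <= l < n.*2.+1) ~~ T l.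

Definition load n (rem : nat -> seq nat) : nat :=
  \sum_(1 <= l < n.*2.+1) size (rem l).

Lemma cnt_put n T y : lit n y -> ~~ T y -> cnt n T = (cnt n (put T y true)).+1.
Proof.
move=> ly Ty; have := @sum_put _ (fun b : bool => nat_of_bool (~~ b)) T y true 1 n.*2.+1.
rewrite -/(cnt n _) -/(cnt n _) Ty /= addn0 addn1 => -> //.
Qed.

Lemma load_put n rem v y r :
  lit n v -> rem v = y :: r -> load n rem = (load n (put rem v r)).+1.
Proof.
move=> ly e; have lv : 1 <= v < n.*2.+1 by move: ly; rewrite /lit; lia.
by have := sum_put size rem r lv; rewrite -!/(load n _) e /=; lia.
Qed.

Lemma load_adj n es : load n (adj es) <= size es.
Proof.
elim: es => [|[u v] es IH].
  by rewrite /load big1 // => i _.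
rewrite /load (eq_bigr (fun l => (u == l) + size (adj es l))); last first.
  by move=> l _; rewrite /adj /=; case: (u == l).
rewrite big_split /= -/(load n _).
suff: \sum_(1 <= i < n.*2.+1) (u == i) <= 1 by lia.
have [h|h] := boolP (1 <= u < n.*2.+1).
  rewrite (bigD1_seq u) ?mem_index_iota ?iota_uniq //= eqxx big1 //.
  by move=> i; rewrite eq_sym => /negbTE ->.
rewrite big_nat_cond big1 // => i; rewrite andbT => hi.
by case: eqP => // e; move: h hi; rewrite e => /negP.
Qed.

(** * First phase: depth-first search *)

(* T: the visited literals; P: literals found to be entailed, collected in pst;
   rem l: the arcs of l not yet scanned; stk: the stack; roots up to x are still
   to be tried. *)
Record dfs_inv n es (x : nat) (T P : nat -> bool) (rem : nat -> seq nat)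
    (stk pst : seq nat) : Prop := DfsInv {
  di_cons : forall l, lit n l -> T l -> ~~ T (neg n l);
  di_stk : forall l, l \in stk -> lit n l /\ T l;
  di_path : sorted (fun a b => (b, a) \in es) stk;
  di_ent : forall l, lit n l -> P l -> entailed n es l;
  di_fin : forall l, lit n l -> T l -> l \notin stk -> rem l = [::];
  di_arc : forall l y, lit n l -> T l -> (l, y) \in es ->
    [|| y \in rem l, T y, P y | P (neg n l)];
  di_rem : forall l y, y \in rem l -> (l, y) \in es;
  di_new : forall l, lit n l -> ~~ T l -> rem l = adj es l;
  di_roots : forall z, x < z <= n -> T z || T (neg n z);
  di_pst : forall l, l \in pst -> lit n l /\ P l;
  di_pst' : forall l, lit n l -> P l -> l \in pst;
  di_size : size pst + cnt n P <= n.*2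
}.

(** Every stack entry is implied by the one below it, so truth spreads from any entry up to the top
    [v]. *)
Lemma path_entails n es g stk v u :
  satg n es g -> path (fun a b => (b, a) \in es) v stk -> u \in v :: stk ->
  ev n g u -> ev n g v.
Proof.
move=> sg; elim: stk v => [|w stk IH] v /=; first by rewrite inE => _ /eqP ->.
case/andP=> wv p; rewrite inE => /orP[/eqP -> //|us] gu.
by apply: sg wv _; exact: IH gu.
Qed.

Lemma dfs_init n es x :
  impl_graph n es -> n <= x ->
  dfs_inv n es x (fun=> false) (fun=> false) (adj es) [::] [::].
Proof.
move=> w nx; split => //.
- by move=> l y; rewrite mem_adj.
- by move=> z; lia.
- by rewrite /cnt sum_nat_const_nat /=; lia.
Qed.

Lemma dfs_root n es x T P rem pst :
  dfs_inv n es x T P rem [::] pst -> 0 < x <= n -> T x || T (neg n x) ->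
  dfs_inv n es x.-1 T P rem [::] pst.
Proof.
case=> Icons Istk Ipath Ient Ifin Iarc Irem Inew Iroots Ipst Ipst' Isize xn Tx; split => // z zx; have [-> //|/eqP zx'] := z =P x.
by apply: Iroots; lia.
Qed.

Lemma dfs_pop n es x T P rem v stk pst :
  dfs_inv n es x T P rem (v :: stk) pst -> rem v = [::] ->
  dfs_inv n es x T P rem stk pst.
Proof.
case=> Icons Istk Ipath Ient Ifin Iarc Irem Inew Iroots Ipst Ipst' Isize e; split => //.
- by move=> l ls; match goal with H : _ |- _ => apply: H; rewrite inE ls orbT end.
- by move: Ipath => /= /path_sorted.
- move=> l ll Tl ls; have [-> //|/eqP lv] := l =P v.
  by apply: Ifin => //; rewrite inE negb_or lv ls.
Qed.

(** Each of the three conditions makes the arc harmless once the second phase has closed [P]: [y] is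
    tentatively true, or it is entailed, or [v] is refuted. *)
Lemma dfs_skip n es x T P rem v y r stk pst :
  dfs_inv n es x T P rem (v :: stk) pst -> rem v = y :: r ->
  [|| T y, P y | P (neg n v)] ->
  dfs_inv n es x T P (put rem v r) (v :: stk) pst.
Proof.
case=> Icons Istk Ipath Ient Ifin Iarc Irem Inew Iroots Ipst Ipst' Isize H H0; split => //.
- move=> l ll Tl ls; rewrite put_neq; first exact: Ifin.
  by move: ls; rewrite inE negb_or => /andP[].
- move=> l z ll Tl lz; have := Iarc _ _ ll Tl lz.
  rewrite /put; case: eqP => // ->; rewrite H inE -orbA => /orP[/eqP -> | //].
  by rewrite H0 orbT.
- move=> l z; rewrite /put; case: eqP => [-> zr|_]; last exact: Irem.
  by apply: Irem; rewrite H inE zr orbT.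
- move=> l ll Tl; rewrite put_neq; first exact: Inew.
  by apply: contraNneq Tl => ->; have [] := Istk v (mem_head _ _).
Qed.

(** [y] is only recorded as entailed and not visited, since [T] must stay consistent. That
    [P (neg n v)] and [P y] have been tested before matters: a finished [neg n y] could have skipped
    its arc to [neg n v] for either reason. *)
Lemma dfs_force n es x T P rem v y r stk pst :
  impl_graph n es ->
  dfs_inv n es x T P rem (v :: stk) pst -> rem v = y :: r ->
  ~~ P (neg n v) -> ~~ T y -> T (neg n y) -> ~~ P y ->
  dfs_inv n es x T (put P y true) (put rem v r) (v :: stk) (y :: pst).
Proof.
move=> wf I ev_ Pv Ty Tny Py.
have [lv Tv] := di_stk I (mem_head _ _).
have vy : (v, y) \in es by apply: (di_rem I); rewrite ev_ mem_head.
have [_ ly nyv] := wf _ _ vy.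
have lny := lit_neg ly; have lnv := lit_neg lv.
have Tnv := di_cons I lv Tv.
(* A finished neg y would have scanned its arc to neg v. *)
have ys : neg n y \in v :: stk.
  apply/negP => /negP ns; have := di_arc I lny Tny nyv.
  by rewrite (di_fin I lny Tny ns) negK // (negbTE Tnv) (negbTE Pv) (negbTE Py).
have ey : entailed n es y.
  move=> g sg; have [gny|] := boolP (ev n g (neg n y)); last first.
    by rewrite ev_neg // negbK.
  by apply: (sg _ _ vy); apply: (path_entails sg _ ys gny); exact: (di_path I).
have mono l : P l -> put P y true l by rewrite /put; case: eqP.
case: I => Icons Istk Ipath Ient Ifin Iarc Irem Inew Iroots Ipst Ipst' Isize; split => //.
- move=> l ll; rewrite /put; case: eqP => [-> _ //|_ Pl]; exact: Ient.
- move=> l ll Tl ls; rewrite put_neq; first exact: Ifin.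
  by move: ls; rewrite inE negb_or => /andP[].
- move=> l z ll Tl lz; have := Iarc _ _ ll Tl lz.
  have h : (z \in rem l) -> (z \in put rem v r l) || put P y true z.
    rewrite {1}/put; case: eqP => [->|_ -> //].
    by rewrite ev_ inE => /orP[/eqP ->|->//]; rewrite putE orbT.
  case/or4P => [/h|->|/mono ->|/mono ->]; rewrite ?orbT //.
  by case/orP=> ->; rewrite ?orbT.
- move=> l z; rewrite {1}/put; case: eqP => [-> zr|_]; last exact: Irem.
  by apply: Irem; rewrite ev_ inE zr orbT.
- move=> l ll Tl; rewrite put_neq; first exact: Inew.
  by apply: contraNneq Tl => ->.
- move=> l; rewrite inE => /orP[/eqP ->|/Ipst [ll /mono ->]] //.
  by rewrite putE.
- move=> l ll; rewrite /put inE; case: eqP => //= _; exact: Ipst'.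
- by move: Isize; rewrite /= (cnt_put ly Py); lia.
Qed.

Lemma dfs_push n es x T P rem y stk pst :
  lit n y ->
  dfs_inv n es x T P rem stk pst -> path (fun a b => (b, a) \in es) y stk ->
  ~~ T y -> ~~ T (neg n y) ->
  dfs_inv n es x (put T y true) P rem (y :: stk) pst.
Proof.
move=> ly I pa Ty Tny.
have mono l : T l -> put T y true l by rewrite /put; case: eqP.
have yny : neg n y != y by move: ly; rewrite /lit /neg; lia.
case: I => Icons Istk Ipath Ient Ifin Iarc Irem Inew Iroots Ipst Ipst' Isize; split => //.
- move=> l ll; rewrite {1}/put; case: eqP => [-> _|ly'] ; first by rewrite put_neq.
  move=> Tl; rewrite put_neq; first exact: Icons.
  by apply: contraTneq Tl => e; have := negK ll; rewrite e => <-.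
- move=> l; rewrite inE => /orP[/eqP ->|/Istk [ll /mono ->]] //.
  by rewrite putE.
- move=> l ll; rewrite {1}/put inE negb_or; case: eqP => //= _; exact: Ifin.
- move=> l z ll; rewrite {1}/put; case: eqP => [-> _ lz|_ Tl lz].
    by rewrite Inew // mem_adj lz.
  by have /or4P[->|/mono ->|->|->] := Iarc _ _ ll Tl lz; rewrite ?orbT.
- move=> l ll; rewrite {1}/put; case: eqP => // _; exact: Inew.
- by move=> z /Iroots /orP[/mono|/mono] ->; rewrite ?orbT.
Qed.

Lemma dfs_visit n es x T P rem v y r stk pst :
  impl_graph n es ->
  dfs_inv n es x T P rem (v :: stk) pst -> rem v = y :: r ->
  ~~ T y -> ~~ T (neg n y) ->
  dfs_inv n es x (put T y true) P (put rem v r) (y :: v :: stk) pst.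
Proof.
move=> wf I e Ty Tny.
have vy : (v, y) \in es by apply: (di_rem I); rewrite e mem_head.
have [lv ly nyv] := wf _ _ vy.
have [_ Tv] := di_stk I (mem_head _ _).
have yv : v != y by apply: contraNneq Ty => <-.
have := dfs_push ly I _ Ty Tny => /(_ _); rewrite /= vy => /(_ (di_path I)) J.
case: J => Icons Istk Ipath Ient Ifin Iarc Irem Inew Iroots Ipst Ipst' Isize; split => //.
- move=> l ll Tl; rewrite !inE !negb_or => /and3P[ly' lv' ls].
  by rewrite put_neq // Ifin // !inE !negb_or ly' lv'.
- move=> l z ll Tl lz; have := Iarc _ _ ll Tl lz.
  rewrite {2}/put; case: eqP => // ->; rewrite e inE -orbA => /orP[/eqP -> | //].
  by rewrite putE /= orbT.
- move=> l z; rewrite /put; case: eqP => [-> zr|_]; last exact: Irem.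
  by apply: Irem; rewrite e inE zr orbT.
- move=> l ll Tl; rewrite put_neq; first exact: Inew.
  by apply: contraNneq Tl => ->; rewrite put_neq.
Qed.

(** * Second phase: closure of the entailed literals *)

(** A graph search from all of [P0] at once: [P] is the set reached so far and [pst] the worklist.
    Soundness is preserved because arcs preserve entailment. *)
Record closure_inv n es (P0 P : nat -> bool) (rem : nat -> seq nat)
    (pst : seq nat) : Prop := ClosureInv {
  ci_sub : forall l, P0 l -> P l;
  ci_ent : forall l, lit n l -> P l -> entailed n es l;
  ci_pst : forall l, l \in pst -> lit n l /\ P l;
  ci_fin : forall l, lit n l -> P l -> l \notin pst -> rem l = [::];
  ci_arc : forall l y, lit n l -> P l -> (l, y) \in es -> (y \in rem l) || P y;
  ci_rem : forall l y, y \in rem l -> (l, y) \in es;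
  ci_new : forall l, lit n l -> ~~ P l -> rem l = adj es l
}.

Lemma closure_init n es T P rem pst :
  dfs_inv n es 0 T P rem [::] pst -> closure_inv n es P P (adj es) pst.
Proof.
case=> Icons Istk Ipath Ient Ifin Iarc Irem Inew Iroots Ipst Ipst' Isize; split => //.
- by move=> l ll Pl; rewrite Ipst'.
- by move=> l y ll Pl; rewrite mem_adj => ->.
- by move=> l y; rewrite mem_adj.
Qed.

Lemma closure_pop n es P0 P rem v pst :
  closure_inv n es P0 P rem (v :: pst) -> rem v = [::] ->
  closure_inv n es P0 P rem pst.
Proof.
case=> Csub Cent Cpst Cfin Carc Crem Cnew e; split => //.
- by move=> l ls; apply: Cpst; rewrite inE ls orbT.
- move=> l ll Tl ls; have [-> //|/eqP lv] := l =P v.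
  by apply: Cfin => //; rewrite inE negb_or lv ls.
Qed.

Lemma closure_skip n es P0 P rem v y r pst :
  closure_inv n es P0 P rem (v :: pst) -> rem v = y :: r -> P y ->
  closure_inv n es P0 P (put rem v r) (v :: pst).
Proof.
case=> Csub Cent Cpst Cfin Carc Crem Cnew H H0; split => //.
- move=> l ll Tl ls; rewrite put_neq; first exact: Cfin.
  by move: ls; rewrite inE negb_or => /andP[].
- move=> l z ll Tl lz; have := Carc _ _ ll Tl lz.
  rewrite /put; case: eqP => // ->; rewrite H inE -orbA => /orP[/eqP -> | //].
  by rewrite H0 orbT.
- move=> l z; rewrite /put; case: eqP => [-> zr|_]; last exact: Crem.
  by apply: Crem; rewrite H inE zr orbT.
- move=> l ll Tl; rewrite put_neq; first exact: Cnew.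
  by apply: contraNneq Tl => ->; have [] := Cpst v (mem_head _ _).
Qed.

Lemma closure_visit n es P0 P rem v y r pst :
  impl_graph n es ->
  closure_inv n es P0 P rem (v :: pst) -> rem v = y :: r -> ~~ P y ->
  closure_inv n es P0 (put P y true) (put rem v r) (y :: v :: pst).
Proof.
move=> wf I e Py.
have vy : (v, y) \in es by apply: (ci_rem I); rewrite e mem_head.
have [lv ly nyv] := wf _ _ vy.
have [_ Pv] := ci_pst I (mem_head _ _).
have yv : v != y by apply: contraNneq Py => <-.
have mono l : P l -> put P y true l by rewrite /put; case: eqP.
case: I => Csub Cent Cpst Cfin Carc Crem Cnew; split => //.
- by move=> l /Csub/mono.
- move=> l ll; rewrite {1}/put; case: eqP => [-> _ g sg|_ Pl]; last exact: Cent.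
  by apply: (sg _ _ vy); apply: Cent.
- move=> l; rewrite inE => /orP[/eqP ->|/Cpst [ll /mono ->]] //.
  by rewrite putE.
- move=> l ll; rewrite {1}/put !inE !negb_or; case: eqP => //= _ Pl.
  by case/andP=> lv' ls; rewrite put_neq // Cfin // inE negb_or lv'.
- move=> l z ll Pl lz; rewrite {1}/put; case: eqP => lv'.
    have := lz; rewrite lv' -mem_adj.
    have := Carc _ _ lv Pv; rewrite -lv' => /(_ _ lz).
    rewrite lv' e inE => /orP[/orP[/eqP ->|->//]|/mono ->]; rewrite ?orbT //.
    by rewrite putE orbT.
  have [ly'|/eqP ly'] := l =P y.
    by subst l; rewrite Cnew // mem_adj lz.
  by move: Pl; rewrite put_neq // => Pl; case/orP: (Carc _ _ ll Pl lz) => [->//|/mono ->]; rewrite orbT.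
- move=> l z; rewrite /put; case: eqP => [-> zr|_]; last exact: Crem.
  by apply: Crem; rewrite e inE zr orbT.
- move=> l ll; rewrite {1}/put; case: eqP => // ly' Pl.
  by rewrite put_neq ?Cnew //; apply: contraNneq Pl => ->.
Qed.

Lemma closure_sat n es T P0 P rem0 rem pst :
  impl_graph n es ->
  dfs_inv n es 0 T P0 rem0 [::] pst -> closure_inv n es P0 P rem [::] ->
  (exists g, satg n es g) <-> (forall l, lit n l -> P l -> ~~ P (neg n l)).
Proof.
move=> wf D C; split=> [[g sg] l ll Pl|cons].
  apply/negP => Pn; have := ci_ent C (lit_neg ll) Pn sg.
  by rewrite ev_neg // (ci_ent C ll Pl sg).
have closed u v : (u, v) \in es -> P u -> P v.
  move=> uv Pu; have [lu _ _] := wf _ _ uv.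
  by have := ci_arc C lu Pu uv; rewrite (ci_fin C lu Pu).
pose g l := P l || ~~ P (neg n l) && T l.
(* Extending the formula for [g] from variables to all literals takes exactly one of [T l] and
   [T (neg n l)]: every variable has been tried as a root, and [T] is consistent. *)
have evg l : lit n l -> ev n g l = P l || ~~ P (neg n l) && T l.
  rewrite /ev => ll; case: leqP => // nl; rewrite /g negK //.
  have ln := lit_neg ll; have := cons _ ll.
  have := cons _ ln; rewrite negK //.
  have := di_roots D (z := neg n l) _; rewrite negK // => /(_ _) r.
  have {r} : T (neg n l) || T l by apply: r; move: ll ln; rewrite /lit /neg; lia.
  have := di_cons D ln; rewrite negK //.
  case: (P l); case: (P (neg n l)); case: (T l); case: (T (neg n l)) => //= *;
    by auto.
(* Let [u] be true. If [P u], closure gives [P v]. Otherwise [neg n u] is not in [P], hence by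
   contraposition neither is [neg n v], and of the alternatives in [di_arc] only those that make [v]
   true are left. *)
exists g => u v uv; have [lu lv nvu] := wf _ _ uv.
rewrite !evg //; case/orP => [/(closed _ _ uv) -> //|/andP[Pnu Tu]].
have Pnv : ~~ P (neg n v) by apply: contra Pnu; exact: closed.
rewrite Pnv /=; have := di_arc D lu Tu uv; rewrite (di_fin D lu Tu) //=.
by case/or3P=> [->|/(ci_sub C) ->|/(ci_sub C)]; rewrite ?orbT // (negbTE Pnu).
Qed.

(** * Booleans as numbers, and memory updates *)

Lemma natb_neq0 (b : bool) : b <> 0 :> nat -> b.
Proof. by case: b. Qed.

Lemma natb_eq0 (b : bool) : b = 0 :> nat -> ~~ b.
Proof. by case: b. Qed.

Lemma updE m a v : upd m a v a = v.
Proof. by rewrite /upd eqxx. Qed.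

Lemma upd_neq m a v b : b <> a -> upd m a v b = m b.
Proof. by rewrite /upd => /eqP/negbTE ->. Qed.

(** * Registers and memory layout *)

Notation rAns := 0 (only parsing).
Notation rOne := 1 (only parsing).
Notation rN := 2 (only parsing).
Notation rD := 3 (only parsing).
Notation rK := 4 (only parsing).
Notation rN2 := 5 (only parsing).
Notation rA := 6 (only parsing).
Notation rA1 := 7 (only parsing).
Notation rCT := 8 (only parsing).
Notation rCP := 9 (only parsing).
Notation rT := 10 (only parsing).
Notation rP := 11 (only parsing).
Notation rPAR := 12 (only parsing).
Notation rPL := 13 (only parsing).
Notation rDig := 14 (only parsing).
Notation rE := 15 (only parsing).
Notation rTau := 16 (only parsing).
Notation rL := 17 (only parsing).
Notation rZero := 18 (only parsing).
Notation rGo := 19 (only parsing).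
Notation rTmp := 20 (only parsing).
Notation rX := 21 (only parsing).
Notation rV := 22 (only parsing).
Notation rW := 23 (only parsing).
Notation rEd := 24 (only parsing).
Notation rY := 25 (only parsing).
Notation rS := 26 (only parsing).
Notation rS2 := 27 (only parsing).
Notation rBad := 28 (only parsing).

(* Registers 1 to 18 do not change after the initialisation; those from 20 on
   are free for use by any program.  Memory: the input in [0, W), the digits of
   the counter in [W, W+L), seven arrays indexed by 0, ..., 2n, and the arcs. *)
Record consts (n d tau W L : nat) (s : state) : Prop := Consts {
  cs_one : reg s 1 = 1;
  cs_n : reg s 2 = n;
  cs_d : reg s 3 = d;
  cs_K : reg s 4 = n.*2.+1;
  cs_N2 : reg s 5 = n.*2;
  cs_A : reg s 6 = W + L;
  cs_A1 : reg s 7 = W + L + 1;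
  cs_CT : reg s 8 = W + L + n.*2.+1;
  cs_CP : reg s 9 = W + L + 2 * n.*2.+1;
  cs_T : reg s 10 = W + L + 3 * n.*2.+1;
  cs_P : reg s 11 = W + L + 4 * n.*2.+1;
  cs_PAR : reg s 12 = W + L + 5 * n.*2.+1;
  cs_PL : reg s 13 = W + L + 6 * n.*2.+1;
  cs_D : reg s 14 = W;
  cs_E : reg s 15 = W + L + 7 * n.*2.+1;
  cs_tau : reg s 16 = tau;
  cs_L : reg s 17 = L;
  cs_zero : reg s 18 = 0
}.

Definition keeps (s s' : state) : Prop := forall r, r < 20 -> reg s' r = reg s r.

Lemma keeps_refl s : keeps s s. Proof. by []. Qed.

Lemma keeps_trans s1 s2 s3 : keeps s1 s2 -> keeps s2 s3 -> keeps s1 s3.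
Proof. by move=> h1 h2 r r20; rewrite h2 // h1. Qed.

Lemma keeps_over s s' al m :
  all (leq 20) [seq x.1 | x <- al] -> keeps s s' -> keeps s (over s' al m).
Proof.
move=> + h r r20; rewrite -h // reg_over; elim: al => //= -[a v] al IH /= /andP[a20 /IH ->].
by rewrite -[eqn _ _]/(r == a) ifF //; apply/eqP; lia.
Qed.

Lemma consts_keeps n d tau W L s s' :
  consts n d tau W L s -> keeps s s' -> consts n d tau W L s'.
Proof. by case=> c1 c2 c3 c4 c5 c6 c7 c8 c9 c10 c11 c12 c13 c14 c15 c16 c17 c18 h; split; rewrite h. Qed.

(** A product of equations serves as a single multi-rule for [rewrite]. *)
Lemma constsE n d tau W L s s' : consts n d tau W L s -> keeps s s' ->
  (reg s' 1 = 1) * (reg s' 2 = n) * (reg s' 3 = d) * (reg s' 4 = n.*2.+1) *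
  (reg s' 5 = n.*2) * (reg s' 6 = W + L) * (reg s' 7 = W + L + 1) *
  (reg s' 8 = W + L + n.*2.+1) * (reg s' 9 = W + L + 2 * n.*2.+1) *
  (reg s' 10 = W + L + 3 * n.*2.+1) * (reg s' 11 = W + L + 4 * n.*2.+1) *
  (reg s' 12 = W + L + 5 * n.*2.+1) * (reg s' 13 = W + L + 6 * n.*2.+1) *
  (reg s' 14 = W) * (reg s' 15 = W + L + 7 * n.*2.+1) * (reg s' 16 = tau) *
  (reg s' 17 = L) * (reg s' 18 = 0).
Proof. by move=> c h; have [] := consts_keeps c h. Qed.

Definition keepm (B : nat) (m m' : nat -> nat) : Prop := forall a, a < B -> m' a = m a.

Lemma keepm_trans B m1 m2 m3 : keepm B m1 m2 -> keepm B m2 m3 -> keepm B m1 m3.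
Proof. by move=> h1 h2 r r20; rewrite h2 // h1. Qed.

Lemma keepm_upd B m m' a v : B <= a -> keepm B m m' -> keepm B m (upd m' a v).
Proof. move=> Ba h b bB; rewrite upd_neq ?h //; lia. Qed.

(** * Linked lists *)

(** A node is two cells, item and successor. Address 0 can serve as null pointer because [lo] is
    positive in every use; [hi] marks where fresh nodes may be written without disturbing the
    list. *)
Fixpoint chain (m : nat -> nat) (lo hi e : nat) (s : seq nat) : Prop :=
  if s is y :: s' then [/\ lo <= e, e.+1 < hi, m e = y & chain m lo hi (m e.+1) s']
  else e = 0.

Lemma chain_frame m m' lo hi hi' e s :
  (forall a, lo <= a < hi -> m' a = m a) -> hi <= hi' ->
  chain m lo hi e s -> chain m' lo hi' e s.
Proof.
move=> h hh; elim: s e => //= y s IH e [h1 h2 h3 h4]; split; first by [].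
- lia.
- by rewrite h //; lia.
- by rewrite h; [exact: IH | lia].
Qed.

(** The successor of an item is stored in an array indexed by the item itself, so nothing is
    allocated; this works as long as no literal occurs twice. *)
Fixpoint links (n : nat) (m : nat -> nat) (b v : nat) (s : seq nat) : Prop :=
  if s is a :: s' then [/\ lit n a, v = a & links n m b (m (b + a)) s'] else v = 0.

Lemma links_frame n m m' b v s :
  (forall a, lit n a -> a \in s -> m' (b + a) = m (b + a)) ->
  links n m b v s -> links n m' b v s.
Proof.
elim: s v => //= y s IH v h [h1 h2 h3]; split => //.
rewrite h //; last by rewrite inE eqxx.
by apply: IH => // a la as_; apply: h; rewrite // inE as_ orbT.
Qed.

(** [remT] and [remP] are read from separate heads into the same pool of nodes. Scanning an arc
    advances a head and leaves the nodes intact, so the first phase does not spoil the lists of the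
    second. *)
Record graph_rep (n B hi : nat) (m : nat -> nat) (T P : nat -> bool)
    (remT remP : nat -> seq nat) (stk : seq nat) (v : nat) (pst : seq nat) (w : nat) :
    Prop := GraphRep {
  gr_T : forall l, lit n l -> m (B + 3 * n.*2.+1 + l) = T l;
  gr_P : forall l, lit n l -> m (B + 4 * n.*2.+1 + l) = P l;
  gr_CT : forall l, lit n l ->
    chain m (B + 7 * n.*2.+1) hi (m (B + n.*2.+1 + l)) (remT l);
  gr_CP : forall l, lit n l ->
    chain m (B + 7 * n.*2.+1) hi (m (B + 2 * n.*2.+1 + l)) (remP l);
  gr_stk : links n m (B + 5 * n.*2.+1) v stk;
  gr_pst : links n m (B + 6 * n.*2.+1) w pst
}.

Ltac frame_tac :=
  first [ by move=> l ll; rewrite upd_neq; [auto | unfold lit in *; lia]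
        | by move=> l ll; rewrite upd_neq;
            [ apply: chain_frame (leqnn _) _; [ | eauto ];
              move=> a aa; apply: upd_neq; unfold lit in *; lia
            | unfold lit in *; lia ]
        | by apply: links_frame; [ | eauto ];
            move=> a la aa; apply: upd_neq; unfold lit in *; lia ].

Lemma rep_T n B hi m T P remT remP stk v pst w y :
  graph_rep n B hi m T P remT remP stk v pst w -> lit n y ->
  graph_rep n B hi (upd m (B + 3 * n.*2.+1 + y) 1) (put T y true) P remT remP stk v pst w.
Proof.
case=> hT hP hCT hCP hs hp ly; have ly' := ly; rewrite /lit in ly'; split; try frame_tac.
move=> l ll; rewrite /put; case: eqP => [->|ne]; first by rewrite updE.
by rewrite upd_neq; [auto | lia].
Qed.

Lemma rep_P n B hi m T P remT remP stk v pst w y :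
  graph_rep n B hi m T P remT remP stk v pst w -> lit n y ->
  graph_rep n B hi (upd m (B + 4 * n.*2.+1 + y) 1) T (put P y true) remT remP stk v pst w.
Proof.
case=> hT hP hCT hCP hs hp ly; have ly' := ly; rewrite /lit in ly'; split; try frame_tac.
move=> l ll; rewrite /put; case: eqP => [->|ne]; first by rewrite updE.
by rewrite upd_neq; [auto | lia].
Qed.

Lemma rep_CT n B hi m T P remT remP stk v pst w y e r :
  graph_rep n B hi m T P remT remP stk v pst w -> lit n y ->
  chain m (B + 7 * n.*2.+1) hi e r ->
  graph_rep n B hi (upd m (B + n.*2.+1 + y) e) T P (put remT y r) remP stk v pst w.
Proof.
case=> hT hP hCT hCP hs hp ly c; have ly' := ly; rewrite /lit in ly'; split; try frame_tac.
move=> l ll; have fr a : B + 7 * n.*2.+1 <= a < hi -> upd m (B + n.*2.+1 + y) e a = m a.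
  by move=> aa; apply: upd_neq; lia.
rewrite /put; case: eqP => [->|ne]; first by rewrite updE; apply: chain_frame c.
by rewrite upd_neq; [apply: chain_frame (hCT _ ll) | lia].
Qed.

Lemma rep_CP n B hi m T P remT remP stk v pst w y e r :
  graph_rep n B hi m T P remT remP stk v pst w -> lit n y ->
  chain m (B + 7 * n.*2.+1) hi e r ->
  graph_rep n B hi (upd m (B + 2 * n.*2.+1 + y) e) T P remT (put remP y r) stk v pst w.
Proof.
case=> hT hP hCT hCP hs hp ly c; have ly' := ly; rewrite /lit in ly'; split; try frame_tac.
move=> l ll; have fr a : B + 7 * n.*2.+1 <= a < hi -> upd m (B + 2 * n.*2.+1 + y) e a = m a.
  by move=> aa; apply: upd_neq; lia.
rewrite /put; case: eqP => [->|ne]; first by rewrite updE; apply: chain_frame c.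
by rewrite upd_neq; [apply: chain_frame (hCP _ ll) | lia].
Qed.

Lemma rep_push_stk n B hi m T P remT remP stk v pst w y :
  graph_rep n B hi m T P remT remP stk v pst w -> lit n y -> y \notin stk ->
  graph_rep n B hi (upd m (B + 5 * n.*2.+1 + y) v) T P remT remP (y :: stk) y pst w.
Proof.
case=> hT hP hCT hCP hs hp ly c; have ly' := ly; rewrite /lit in ly'; split; try frame_tac.
split => //; rewrite updE; apply: links_frame hs => a la as_; apply: upd_neq.
by have : a <> y by [move=> e; rewrite -e as_ in c]; lia.
Qed.

Lemma rep_push_pst n B hi m T P remT remP stk v pst w y :
  graph_rep n B hi m T P remT remP stk v pst w -> lit n y -> y \notin pst ->
  graph_rep n B hi (upd m (B + 6 * n.*2.+1 + y) w) T P remT remP stk v (y :: pst) y.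
Proof.
case=> hT hP hCT hCP hs hp ly c; have ly' := ly; rewrite /lit in ly'; split; try frame_tac.
split => //; rewrite updE; apply: links_frame hp => a la as_; apply: upd_neq.
by have : a <> y by [move=> e; rewrite -e as_ in c]; lia.
Qed.

(** * The 2-SAT solver *)

(** Scanning an arc, popping and trying a root are branches of one loop body of bounded cost, so
    that a single potential bounds the running time. A null [rV] means an empty stack and a null
    [rEd] an exhausted list. *)
Definition dfs_body : cmd :=
  If rV
   (Fetch rEd rCT rV ;;
    If rEd
     (Read rY rEd ;; Add rEd rEd rOne ;; Read rEd rEd ;; Store rCT rV rEd ;;
      Sub rS rK rV ;; Fetch rS rP rS ;;
      If rS Skip
       (Fetch rS rT rY ;;
        If rS Skip
         (Sub rS rK rY ;; Fetch rS rT rS ;;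
          If rS
           (Fetch rS rP rY ;;
            If rS Skip (Store rP rY rOne ;; Store rPL rY rW ;; Add rW rY rZero))
           (Store rT rY rOne ;; Store rPAR rY rV ;; Add rV rY rZero))))
     (Fetch rV rPAR rV))
   (Fetch rS rT rX ;; Sub rS2 rK rX ;; Fetch rS2 rT rS2 ;; Add rS rS rS2 ;;
    If rS (Sub rX rX rOne)
     (Store rT rX rOne ;; Store rPAR rX rV ;; Add rV rX rZero)).

Definition dfs_loop : cmd := While rX dfs_body.

Definition closure_loop : cmd :=
  While rW
   (Fetch rEd rCP rW ;;
    If rEd
     (Read rY rEd ;; Add rEd rEd rOne ;; Read rEd rEd ;; Store rCP rW rEd ;;
      Fetch rS rP rY ;;
      If rS Skip (Store rP rY rOne ;; Store rPL rY rW ;; Add rW rY rZero))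
     (Fetch rW rPL rW)).

Definition check_loop : cmd :=
  While rX
   (Fetch rS rP rX ;; Sub rS2 rK rX ;; Fetch rS2 rP rS2 ;;
    If rS (Add rBad rBad rS2) Skip ;; Sub rX rX rOne).

(* Unvisited literals count twice in the potential, because a root is pushed on
   the stack without consuming an arc. *)
Definition dfs_state n es B hi s0 kr (s : state) k : Prop :=
  exists T P rem stk pst,
    [/\ keeps s0 s /\ keepm B (mem s0) (mem s), reg s rBad = reg s0 rBad,
        dfs_inv n es (reg s rX) T P rem stk pst /\ (reg s rX <= n /\ (reg s rX = 0 -> stk = [::])),
        graph_rep n B hi (mem s) T P rem (adj es) stk (reg s rV) pst (reg s rW)
      & kr + 30 * (load n rem + size stk + 2 * cnt n T + reg s rX) + 1 <= k].

(** Every branch lowers the potential of [dfs_state] by at least one unit, and the 30 credits of a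
    unit cover the longest branch and the loop test. *)
Lemma dfs_body_ok n d tau W L es hi s0 kr s k :
  consts n d tau W L s0 -> impl_graph n es ->
  reg s rX <> 0 ->
  dfs_state n es (W + L) hi s0 kr s (31 + k) ->
  wp dfs_body (dfs_state n es (W + L) hi s0 kr) s (30 + k).
Proof.
move=> c0 wf x0 [T [P [rem [stk [pst [[ks km] bad [I [xn xs]] R kk]]]]]].
have csE := constsE c0 ks.
have [hT hP hCT hCP hs hp] := R.
start; rewrite /dfs_body; branch csE.
  case: stk I R xs kk hs => [|v stk] I R xs kk hs; first by rewrite hs.
  have [lv ev_ _] := hs => v0; rewrite ev_ in R *.
  have chv := hCT v lv.
  have lnv := lit_neg lv.
  branch (csE, ev_).
    case er : (rem v) chv => [|y r] /=; first by move=> -> .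
    move=> [e1 e2 ey chr] _.
    have vy : (v, y) \in es by apply: (di_rem I); rewrite er mem_head.
    have [_ ly _] := wf _ _ vy; have lny := lit_neg ly.
    have R1 := rep_CT R lv chr.
    have [hT1 hP1 _ _ _ _] := R1.
    set e := mem s _ in e1 e2 ey chr R1 hT1 hP1 *.
    have ld := load_put lv er.
    have skip_ok s' k' : keeps s0 s' -> keepm (W + L) (mem s0) (mem s') ->
        reg s' 28 = reg s0 28 -> reg s' 21 = reg s 21 -> reg s' 22 = v ->
        reg s' 23 = reg s 23 ->
        mem s' = upd (mem s) (W + L + n.*2.+1 + v) (mem s e.+1) ->
        [|| T y, P y | P (neg n v)] -> k < k' ->
        dfs_state n es (W + L) hi s0 kr s' k'.
      move=> h1 h2 h3 h4 h5 h6 h7 h8 h9.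
      exists T, P, (put rem v r), (v :: stk), pst; split=> //.
      + by rewrite h4; split; [exact: dfs_skip I er h8 | split].
      + by rewrite h5 h6 h7.
      + by rewrite h4; nlia.
    branch (csE, ev_, ey, addn1); rewrite -/(neg n v) (hP1 _ lnv).
      move=> /natb_neq0 Pv; step; apply: skip_ok; simp; rewrite ?(csE, ev_) //; first exact: keeps_over.
      + by do ?[apply: keepm_upd; first by nlia].
      + by rewrite Pv !orbT.
      + nlia.
    move=> /natb_eq0 Pv; branch (csE, ev_); rewrite (hT1 _ ly).
      move=> /natb_neq0 Ty; step; apply: skip_ok; simp; rewrite ?(csE, ev_) //; first exact: keeps_over.
      + by do ?[apply: keepm_upd; first by nlia].
      + by rewrite Ty.
      + nlia.
    move=> /natb_eq0 Ty; branch (csE, ev_); rewrite -/(neg n y) (hT1 _ lny).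
      move=> /natb_neq0 Tny; branch (csE, ev_); rewrite (hP1 _ ly).
        move=> /natb_neq0 Py; step; apply: skip_ok; simp; rewrite ?(csE, ev_) //; first exact: keeps_over.
      + by do ?[apply: keepm_upd; first by nlia].
        * by rewrite Py !orbT.
        * nlia.
      move=> /natb_eq0 Py; run (csE, ev_, addn0).
      have ypst : y \notin pst by apply: contra Py => /(di_pst I) [].
      exists T, (put P y true), (put rem v r), (v :: stk), (y :: pst).
      split; simp; rewrite ?(csE, ev_).
      + by split; [exact: keeps_over | do ?[apply: keepm_upd; first by nlia]].
      + by [].
      + by split => //; exact: dfs_force.
      + by apply: rep_push_pst => //; exact: rep_P.
      + nlia.
    move=> /natb_eq0 Tny; run (csE, ev_, addn0).
    have ystk : y \notin v :: stk by apply: contra Ty => /(di_stk I) [].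
    exists (put T y true), P, (put rem v r), (y :: v :: stk), pst.
    have := cnt_put ly Ty.
    split; simp; rewrite ?(csE, ev_).
    + by split; [exact: keeps_over | do ?[apply: keepm_upd; first by nlia]].
    + by [].
    + by split => //; exact: dfs_visit.
    + by apply: rep_push_stk => //; exact: rep_T.
    + by rewrite /= in kk *; nlia.
  case er : (rem v) chv => [|y r] /=; last by move=> [? ? _ _]; nlia.
  move=> _ _; run (csE, ev_).
  exists T, P, rem, stk, pst; split; simp; rewrite ?(csE, ev_).
  + by split; [exact: keeps_over | do ?[apply: keepm_upd; first by nlia]].
  + by [].
  + by split; [exact: dfs_pop I er | split].
  + by split=> //; case: hs.
  + by rewrite /= in kk; nlia.
move=> v0; have lx : lit n (reg s 21) by rewrite /lit; nlia.
have lnx := lit_neg lx.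
(* Codes of literals are positive, so a null top pointer belongs to the empty stack. *)
have st0 : stk = [::].
  by case: stk hs {I R xs kk} => //= a st [la]; rewrite v0 => e; move: la; rewrite -e /lit.
subst stk; rewrite v0 in R *.
branch csE; rewrite -/(neg n _) (hT _ lx) (hT _ lnx) => tx; run (csE, v0, addn0).
  exists T, P, rem, [::], pst; split; simp; rewrite ?csE.
  + by split; [exact: keeps_over | do ?[apply: keepm_upd; first by nlia]].
  + by [].
  + split; last by split => //; nlia.
    rewrite subn1; apply: dfs_root => //; first by nlia.
    by case: (T _) tx => //; case: (T _).
  + by [].
  + by rewrite /= in kk *; nlia.
have Tx : ~~ T (reg s 21) by case: (T _) tx.
have Tnx : ~~ T (neg n (reg s 21)) by move: tx; case: (T (neg _ _)) => //; nlia.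
exists (put T (reg s 21) true), P, rem, [:: reg s 21], pst.
have := cnt_put lx Tx.
split; simp; rewrite ?csE.
+ by split; [exact: keeps_over | do ?[apply: keepm_upd; first by nlia]].
+ by [].
+ by split => //; exact: dfs_push.
+ by apply: rep_push_stk => //; exact: rep_T.
+ by rewrite /= in kk *; nlia.
Qed.

(** The term [5 * n] is the initial potential apart from the arcs: 2n unvisited literals of weight
    two, and n roots. *)
Lemma dfs_loop_ok n d tau W L es hi kr Q s k :
  consts n d tau W L s -> impl_graph n es ->
  graph_rep n (W + L) hi (mem s) (fun=> false) (fun=> false) (adj es) (adj es)
    [::] (reg s rV) [::] (reg s rW) ->
  reg s rX = n ->
  kr + 30 * (size es + 5 * n) + 1 <= k ->
  (forall s' k' T P rem pst, kr <= k' -> keeps s s' -> keepm (W + L) (mem s) (mem s') ->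
     reg s' rBad = reg s rBad ->
     dfs_inv n es 0 T P rem [::] pst ->
     graph_rep n (W + L) hi (mem s') T P rem (adj es) [::] (reg s' rV) pst (reg s' rW) ->
     Q s' k') ->
  wp dfs_loop Q s k.
Proof.
move=> c0 wf R xn kk post; apply: (@wp_while _ _ (dfs_state n es (W + L) hi s kr)).
  exists (fun=> false), (fun=> false), (adj es), [::], [::]; rewrite xn; split=> //.
    by split=> //; exact: dfs_init.
  have := load_adj n es; rewrite /= /cnt sum_nat_const_nat /=; nlia.
move=> s' k' I; have [T [P [rem [stk [pst [[ks km] bad [D [xn' xs]] R' kk']]]]]] := I.
split; first by nlia.
split=> x0; last first.
  have -> : k' - 1 = 30 + (k' - 31) by nlia.
  by apply: (dfs_body_ok c0 wf x0); have -> : 31 + (k' - 31) = k' by nlia.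
have s0 := xs x0; subst stk; rewrite x0 in D.
by apply: (post _ _ T P rem pst) => //; nlia.
Qed.

(** Weight one suffices for unmarked literals: a new worklist entry is balanced by one unmarked
    literal less, and the scanned arc pays for the iteration. *)
Definition closure_state n es B hi s0 kr P0 (s : state) k : Prop :=
  exists T remT stk v P rem pst,
    [/\ keeps s0 s /\ keepm B (mem s0) (mem s), reg s rBad = reg s0 rBad,
        closure_inv n es P0 P rem pst,
        graph_rep n B hi (mem s) T P remT rem stk v pst (reg s rW)
      & kr + 20 * (load n rem + size pst + cnt n P) + 1 <= k].

(** The bound on [size pst] says that the worklist has at most as many entries as there are marked
    literals; with it the initial potential is at most the number of arcs plus 2n. *)
Lemma closure_loop_ok n d tau W L es hi kr T P0 remT stk v pst Q s k :
  consts n d tau W L s -> impl_graph n es ->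
  graph_rep n (W + L) hi (mem s) T P0 remT (adj es) stk v pst (reg s rW) ->
  closure_inv n es P0 P0 (adj es) pst -> size pst + cnt n P0 <= n.*2 ->
  kr + 20 * (size es + n.*2) + 1 <= k ->
  (forall s' k' T P remT rem stk v w, kr <= k' -> keeps s s' ->
     keepm (W + L) (mem s) (mem s') -> reg s' rBad = reg s rBad ->
     closure_inv n es P0 P rem [::] ->
     graph_rep n (W + L) hi (mem s') T P remT rem stk v [::] w ->
     Q s' k') ->
  wp closure_loop Q s k.
Proof.
move=> c0 wf R0 C0 sz kk post.
apply: (@wp_while _ _ (closure_state n es (W + L) hi s kr P0)).
  exists T, remT, stk, v, P0, (adj es), pst; split=> //.
  have := load_adj n es; nlia.
move=> s' k' {T R0 remT stk v C0 pst sz kk k}.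
move=> [T [remT [stk [v [P [rem [pst [[ks km] bad C R kk]]]]]]]].
have csE := constsE c0 ks.
split; first by nlia.
have [hT hP hCT hCP hs hp] := R.
split=> w0.
  case: pst C R kk hp => [|a pst] C R kk hp.
    by apply: (post _ _ T P remT rem stk v (reg s' rW)) => //; nlia.
  by case: hp => la e _; move: la; rewrite -e w0.
case: pst C R kk hp => [|u pst] C R kk hp; first by rewrite hp in w0.
have [lu eu _] := hp; rewrite eu in R.
have [_ Pu] := ci_pst C (mem_head _ _).
have chu := hCP u lu.
have {k' kk} [k -> kk] : exists2 k, k' - 1 = 20 + k &
    kr + 20 * (load n rem + size (u :: pst) + cnt n P) <= 20 + k.
  by exists (k' - 21); rewrite /= in kk *; nlia.
start; branch (csE, eu).
  case er : (rem u) chu => [|y r] /=; first by move=> -> .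
  move=> [e1 e2 ey chr] _.
  have uy : (u, y) \in es by apply: (ci_rem C); rewrite er mem_head.
  have [_ ly _] := wf _ _ uy.
  have R1 := rep_CP R lu chr.
  have [_ hP1 _ _ _ _] := R1.
  set e := mem s' _ in e1 e2 ey chr R1 hP1 *.
  have ld := load_put lu er.
  branch (csE, eu, ey, addn1); rewrite (hP1 _ ly).
    move=> /natb_neq0 Py; step.
    exists T, remT, stk, v, P, (put rem u r), (u :: pst); split; simp; rewrite ?(csE, eu) //.
    + by split; [exact: keeps_over | do ?[apply: keepm_upd; first by nlia]].
    + exact: closure_skip C er Py.
    + by rewrite /= in kk *; nlia.
  move=> /natb_eq0 Py; run (csE, eu, addn0).
  have ypst : y \notin u :: pst by apply: contra Py => /(ci_pst C) [].
  have cp := cnt_put ly Py.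
  exists T, remT, stk, v, (put P y true), (put rem u r), (y :: u :: pst).
  split; simp; rewrite ?(csE, eu) //.
  + by split; [exact: keeps_over | do ?[apply: keepm_upd; first by nlia]].
  + exact: closure_visit.
  + by apply: rep_push_pst => //; exact: rep_P.
  + by rewrite /= in kk *; nlia.
case er : (rem u) chu => [|y r] /=; last by move=> [? ? _ _]; nlia.
move=> _ _; run (csE, eu).
exists T, remT, stk, v, P, rem, pst; split; simp; rewrite ?(csE, eu) //.
+ by split; [exact: keeps_over | do ?[apply: keepm_upd; first by nlia]].
+ exact: closure_pop C er.
+ by case: R => ? ? ? ? ? [_ _ hp']; split.
+ by rewrite /= in kk; nlia.
Qed.

Definition check_state n B hi s0 kr P (s : state) k : Prop :=
  [/\ keeps s0 s /\ keepm B (mem s0) (mem s), reg s rX <= n,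
      reg s rBad <> 0 <-> reg s0 rBad <> 0 \/
        exists2 z, reg s rX < z <= n & P z && P (neg n z),
      exists T remT rem stk v pst w, graph_rep n B hi (mem s) T P remT rem stk v pst w
    & kr + 10 * reg s rX + 1 <= k].

Lemma check_loop_ok n d tau W L hi kr T P remT rem stk v pst w Q s k :
  consts n d tau W L s ->
  graph_rep n (W + L) hi (mem s) T P remT rem stk v pst w ->
  reg s rX = n -> kr + 10 * n + 1 <= k ->
  (forall s' k', kr <= k' -> keeps s s' -> keepm (W + L) (mem s) (mem s') ->
     (reg s' rBad <> 0 <-> reg s rBad <> 0 \/
        exists2 z, 0 < z <= n & P z && P (neg n z)) ->
     Q s' k') ->
  wp check_loop Q s k.
Proof.
move=> c0 R xn kk post; apply: (@wp_while _ _ (check_state n (W + L) hi s kr P)).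
  split=> //; rewrite ?xn //.
    by split=> [|[//|[z zn]]]; [left | nlia].
  by exists T, remT, rem, stk, v, pst, w.
move=> s' k' {T remT rem stk v pst w R kk k}.
move=> [[ks km] xn' bad [T [remT [rem [stk [v [pst [w R]]]]]]] kk].
have csE := constsE c0 ks.
split; first by nlia.
split=> x0; first by rewrite x0 in bad; apply: post => //; nlia.
have {k' kk} [k -> kk] : exists2 k, k' - 1 = 9 + k & kr + 10 * reg s' rX <= 10 + k.
  by exists (k' - 10); nlia.
have lx : lit n (reg s' rX) by rewrite /lit; nlia.
have lnx := lit_neg lx.
have [hT hP hCT hCP hs hp] := R.
have main b : (b <> 0 <-> reg s' rBad <> 0 \/ P (reg s' rX) && P (neg n (reg s' rX))) ->
    b <> 0 <-> reg s rBad <> 0 \/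
      exists2 z, reg s' rX - 1 < z <= n & P z && P (neg n z).
  move=> ->; rewrite bad; split.
  - case=> [[|[z zn pz]]|pz]; [by left | right; exists z => //; nlia |].
    by right; exists (reg s' rX) => //; nlia.
  - case=> [|[z zn pz]]; first by left; left.
    have [<-|zx] := z =P reg s' rX; first by right.
    by left; right; exists z => //; nlia.
start; branch csE; rewrite -/(neg n _) (hP _ lx) (hP _ lnx) => px; run csE.
  split; simp; rewrite ?csE //.
  + by split=> //; exact: keeps_over.
  + by nlia.
  + apply: main; rewrite (natb_neq0 px) /=; case: (P (neg _ _)) => /=.
      by split=> _; [right | nlia].
    by rewrite addn0; split=> [|[]] //; left.
  + by exists T, remT, rem, stk, v, pst, w.
  + by nlia.
split; simp; rewrite ?csE //.
+ by split=> //; exact: keeps_over.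
+ by nlia.
+ apply: main; rewrite (negbTE (natb_eq0 px)) /=.
  by split=> [|[]] //; left.
+ by exists T, remT, rem, stk, v, pst, w.
+ by nlia.
Qed.

Definition solve : cmd :=
  Add rX rN rZero ;; Const rV 0 ;; Const rW 0 ;; dfs_loop ;; closure_loop ;;
  Add rX rN rZero ;; check_loop.

(** [rBad] only ever grows here, so an empty clause flagged during the construction of the graph
    still leads to rejection. *)
Lemma solve_ok n d tau W L es hi kr Q s k :
  consts n d tau W L s -> impl_graph n es ->
  graph_rep n (W + L) hi (mem s) (fun=> false) (fun=> false) (adj es) (adj es)
    [::] 0 [::] 0 ->
  kr + 200 * (size es + n + 1) <= k ->
  (forall s' k', kr <= k' -> keeps s s' -> keepm (W + L) (mem s) (mem s') ->
     (reg s' rBad <> 0 <-> reg s rBad <> 0 \/ ~ exists g, satg n es g) -> Q s' k') ->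
  wp solve Q s k.
Proof.
move=> c0 wf R kk post; have csE := constsE c0 (keeps_refl s).
have -> : k = 3 + (k - 3) by nlia.
rewrite /solve; start; run (csE, addn0).
set s1 := over _ _ _; have k1 : keeps s s1 by exact: keeps_over.
apply: (dfs_loop_ok (kr := kr + 20 * (size es + n.*2) + 10 * n + 3) (consts_keeps c0 k1) wf).
+ by rewrite /s1; simp; exact: R.
+ by rewrite /s1; simp.
+ by nlia.
move=> s2 k2 T P rem pst kk2 ks2 km2 bad2 D R2.
have ks2' := keeps_trans k1 ks2.
apply: wp_seq.
apply: (closure_loop_ok (kr := kr + 10 * n + 2) (consts_keeps c0 ks2') wf R2).
+ exact: closure_init D.
+ exact: di_size D.
+ by nlia.
move=> s3 k3 T' P' remT rem' stk v w kk3 ks3 km3 bad3 C R3.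
have ks3' := keeps_trans ks2' ks3.
have -> : k3 = 1 + (k3 - 1) by nlia.
have cs3E := constsE c0 ks3'.
start; run (cs3E, addn0).
set s4 := over _ _ _; have k4 : keeps s s4 by exact: keeps_over.
apply: (check_loop_ok (kr := kr) (consts_keeps c0 k4)); rewrite /s4 ?mem_over.
+ exact: R3.
+ by [].
+ by nlia.
move=> s5 k5 kk5 ks5; rewrite ?mem_over => km5 bad5.
apply: post => //.
+ exact: keeps_trans k4 ks5.
+ by apply: keepm_trans km5; exact: keepm_trans km2 km3.
rewrite bad5 reg_over /= bad3 bad2 reg_over /=.
rewrite (closure_sat wf D C); split; case=> [|h]; [by left| |by left|]; right.
  by move=> cons; case: h => z zn /andP[pz]; apply/negP/cons => //; rewrite /lit; nlia.
(* Of two opposite literals one is a variable, so checking the codes 1, ..., n finds every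
   contradiction. *)
have [/hasP[z]|/hasPn nz] := boolP (has (fun z => P' z && P' (neg n z)) (iota 1 n)).
  by rewrite mem_iota => zn pz; exists z => //; nlia.
case: h => l ll Pl; apply/negP => Pnl.
have [ln|nl] := leqP l n.
  by have := nz l; rewrite mem_iota Pl Pnl; move: ll; rewrite /lit => ? /(_ _) h; apply: notF; apply: h; nlia.
have := nz (neg n l); rewrite mem_iota negK // Pl Pnl /=.
by move: ll; rewrite /lit /neg => ? /(_ _) h; apply: notF; apply: h; lia.
Qed.

(** * Construction of the implication graph *)

Definition same (l : seq nat) (s s' : state) : Prop :=
  forall r, r \notin l -> reg s' r = reg s r.

Lemma same_over l s s' al m :
  all (fun r => r \in l) [seq x.1 | x <- al] -> same l s s' -> same l s (over s' al m).
Proof.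
move=> + h r rl; rewrite -h // reg_over; elim: al => //= -[a v] al IH /= /andP[al' /IH ->].
by rewrite -[eqn _ _]/(r == a) ifF //; apply: contraNF rl => /eqP ->.
Qed.

Lemma same_keeps l s s' : all (leq 20) l -> same l s s' -> keeps s s'.
Proof.
move=> /allP h ss r r20; apply: ss; apply/negP => /h; lia.
Qed.

Definition at_ (m : nat -> nat) (p : nat) (s : seq nat) : Prop :=
  forall i, i < size s -> m (p + i) = nth 0 s i.

Lemma at_cons m p a s : at_ m p (a :: s) <-> m p = a /\ at_ m p.+1 s.
Proof.
split=> [h|[h1 h2] [|i] /= ii]; last 2 first.
- by rewrite addn0.
- by rewrite addnS -addSn h2.
split; first by have := h 0 isT; rewrite addn0.
by move=> i ii; have := h i.+1 ii; rewrite addnS.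
Qed.

Lemma at_cat m p s1 s2 : at_ m p (s1 ++ s2) <-> at_ m p s1 /\ at_ m (p + size s1) s2.
Proof.
elim: s1 p => [|a s1 IH] p /=; first by rewrite addn0; split=> [h|[]].
by rewrite !at_cons IH addSnnS; tauto.
Qed.

Lemma at_frame B m m' p s : at_ m p s -> p + size s <= B -> keepm B m m' -> at_ m' p s.
Proof. by move=> h pB k i ii; rewrite k ?h //; lia. Qed.

Notation rPos := 29 (only parsing).
Notation rQ := 30 (only parsing).
Notation rI := 31 (only parsing).
Notation rJ := 32 (only parsing).
Notation rC := 33 (only parsing).
Notation rLen := 34 (only parsing).
Notation rLa := 35 (only parsing).
Notation rLb := 36 (only parsing).
Notation rFe := 37 (only parsing).
Notation rQ2 := 38 (only parsing).

(* A x.+1 is the literal over the single unknown assignment that gives the value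
   of variable x in the current stage. *)
Definition code n (A : nat -> nat) (l : literal n) : nat :=
  if l.2 then A l.1.+1 else neg n (A l.1.+1).

(* A clause with one literal is read as that literal twice. *)
Definition clause_arcs n (A : nat -> nat) (es : seq (nat * nat)) (c : seq (literal n)) :=
  if c is l :: c' then
    (neg n (code A (last l c')), code A l) :: (neg n (code A l), code A (last l c')) :: es
  else es.

(* Toggling the digit 0 is harmless, since A 0 is never read. *)
Definition toggle n (A : nat -> nat) (x : nat) : nat -> nat := put A x (neg n (A x)).

(** [A] is passed on from stage to stage, so a flip stays in force and all arcs speak of the same
    unknown assignment. Flips before the first stage amount to another choice of that assignment,
    which lets all stages be treated alike. *)
Fixpoint arcs n d (A : nat -> nat) (es : seq (nat * nat)) (phis : seq (cnf2 n))
    (ds : seq nat) : seq (nat * nat) :=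
  if phis is phi :: phis' then
    let A' := foldl (toggle n) A (take d ds) in
    arcs d A' (foldl (fun es (c : clause n) => clause_arcs A' es c) es phi) phis' (drop d ds)
  else es.

Definition lit_valued n (A : nat -> nat) : Prop := forall l, 0 < l <= n -> lit n (A l).

Lemma lit_code n A (l : literal n) : lit_valued n A -> lit n (code A l).
Proof.
move=> vA; have h : lit n (A l.1.+1) by apply: vA; rewrite ltnS leq0n ltn_ord.
by rewrite /code; case: l.2 => //; exact: lit_neg.
Qed.

Lemma lit_toggle n A x : lit_valued n A -> lit_valued n (toggle n A x).
Proof.
move=> vA l ln; rewrite /toggle /put; case: eqP => [<-|_]; last exact: vA.
by apply/lit_neg/vA.
Qed.

Lemma impl_graph_clause n A es (c : seq (literal n)) :
  lit_valued n A -> impl_graph n es -> impl_graph n (clause_arcs A es c).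
Proof.
move=> vA wf; case: c => //= l c.
have h1 := lit_code l vA; have h2 := lit_code (last l c) vA.
have h3 := lit_neg h1; have h4 := lit_neg h2.
move=> u v; rewrite !inE => /or3P[/eqP[-> ->]|/eqP[-> ->]|uv].
- by split; rewrite ?inE ?negK ?eqxx ?orbT.
- by split; rewrite ?inE ?negK ?eqxx.
- by have [? ? e] := wf _ _ uv; split; rewrite ?inE ?e ?orbT.
Qed.

(** The graph of the arcs so far, with no literal marked. An empty clause yields no arc, so [b]
    remembers whether one was met. *)
Record build_inv n W L s0 s es A (b : bool) : Prop := BuildInv {
  bi_keeps : keeps s0 s;
  bi_keepm : keepm (W + L) (mem s0) (mem s);
  bi_rep : graph_rep n (W + L) (reg s rFe) (mem s) (fun=> false) (fun=> false)
             (adj es) (adj es) [::] 0 [::] 0;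
  bi_fe : W + L + 7 * n.*2.+1 <= reg s rFe;
  bi_A : forall l, 0 < l <= n -> mem s (W + L + l) = A l;
  bi_lit : lit_valued n A;
  bi_wf : impl_graph n es;
  bi_bad : reg s rBad <> 0 <-> b
}.

(** Before the search the two lists of a vertex have equal contents, so one node, linked to the old
    head in [rCT], becomes the new head of both. *)
Definition arc : cmd :=
  Write rFe rV ;; Add rS rFe rOne ;; Fetch rEd rCT rX ;; Write rS rEd ;;
  Store rCT rX rFe ;; Store rCP rX rFe ;; Add rFe rS rOne.

Lemma arc_ok n d tau W L es Q s k :
  consts n d tau W L s -> lit n (reg s rX) ->
  graph_rep n (W + L) (reg s rFe) (mem s) (fun=> false) (fun=> false)
    (adj es) (adj es) [::] 0 [::] 0 ->
  W + L + 7 * n.*2.+1 <= reg s rFe ->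
  (forall s', same [:: rTmp; rEd; rS; rFe] s s' ->
     keepm (W + L + n.*2.+1) (mem s) (mem s') ->
     graph_rep n (W + L) (reg s' rFe) (mem s') (fun=> false) (fun=> false)
       (adj ((reg s rX, reg s rV) :: es)) (adj ((reg s rX, reg s rV) :: es)) [::] 0 [::] 0 ->
     W + L + 7 * n.*2.+1 <= reg s' rFe -> Q s' k) ->
  wp arc Q s (10 + k).
Proof.
move=> c0 lx R fe post; have csE := constsE c0 (keeps_refl s).
have lx' := lx; rewrite /lit in lx'.
have [hT hP hCT hCP hs hp] := R.
rewrite /arc; start; run (csE, addn1).
set M := upd (upd (upd (upd _ _ _) _ _) _ _) _ _.
have MX a : a < W + L + n.*2.+1 -> M a = mem s a.
  by move=> ha; rewrite /M !upd_neq //; nlia.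
have Mhead l : lit n l -> M (W + L + n.*2.+1 + l) =
    if l == reg s 21 then reg s 37 else mem s (W + L + n.*2.+1 + l).
  move=> ll; rewrite /M upd_neq; last by unfold lit in ll; nlia.
  case: eqP => [->|ne]; first by rewrite updE.
  by rewrite !upd_neq //; unfold lit in ll; nlia.
have Mhead' l : lit n l -> M (W + L + 2 * n.*2.+1 + l) =
    if l == reg s 21 then reg s 37 else mem s (W + L + 2 * n.*2.+1 + l).
  move=> ll; rewrite /M; case: eqP => [->|ne]; first by rewrite updE.
  by rewrite !upd_neq //; unfold lit in ll; nlia.
have Mfe : M (reg s 37) = reg s 22.
  by rewrite /M 3?upd_neq ?updE //; nlia.
have Mfe1 : M (reg s 37).+1 = mem s (W + L + n.*2.+1 + reg s 21).
  by rewrite /M upd_neq ?(@upd_neq _ (W + L + n.*2.+1 + reg s 21)) ?updE ?upd_neq //; nlia.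
have Mch e st : chain (mem s) (W + L + 7 * n.*2.+1) (reg s 37) e st ->
    chain M (W + L + 7 * n.*2.+1) (reg s 37).+2 e st.
  apply: chain_frame; last by nlia.
  by move=> a aa; rewrite /M !upd_neq //; nlia.
have Mnew : chain M (W + L + 7 * n.*2.+1) (reg s 37).+2 (reg s 37) (reg s 22 :: adj es (reg s 21)).
  by split; rewrite ?Mfe ?Mfe1 //; apply: Mch; exact: hCT.
have adjE l : adj ((reg s 21, reg s 22) :: es) l =
    if l == reg s 21 then reg s 22 :: adj es l else adj es l.
  by rewrite /adj /= eq_sym; case: eqP.
apply: post; simp.
- by apply: same_over.
- exact: MX.
- split=> //.
  + by move=> l ll; rewrite /M !upd_neq ?hT //; unfold lit in ll; nlia.
  + by move=> l ll; rewrite /M !upd_neq ?hP //; unfold lit in ll; nlia.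
  + by move=> l ll; rewrite Mhead // adjE; case: eqP => [->|_] //; apply: Mch; exact: hCT.
  + by move=> l ll; rewrite Mhead' // adjE; case: eqP => [->|_] //; apply: Mch; exact: hCP.
- by nlia.
Qed.

(** Both outcomes are merged into one symbolic state; otherwise the two sign tests of a clause would
    split its execution into four. *)
Lemma wp_cond_sub r a b (Q : state -> nat -> Prop) s al m c k :
  Q (over s (set al b (if get (reg s) al r == 0 then get (reg s) al a - get (reg s) al b
                       else get (reg s) al b)) m) (c + k) ->
  wp (If r Skip (Sub b a b)) Q (over s al m) (c.+2 + k).
Proof.
move=> q; apply: wp_if => [/eqP/negbTE e|e].
  apply: wp_skip; rewrite e -over_set in q.
  suff -> : over s al m = set_reg (over s al m) b (get (reg s) al b) by [].
  rewrite over_set; apply: over_ext => r'; rewrite get_set.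
  by case: eqP => // ->.
by apply: wp_sub; rewrite e in q.
Qed.

(** The second literal is read backwards from the end of the clause, which yields the first one
    again in a unit clause. The base [rA1] is [rA] plus one because variables are stored from 0 but
    coded from 1. *)
Definition clause_body : cmd :=
  Read rLen rPos ;;
  If rLen
   (Add rQ2 rPos rOne ;; Read rY rQ2 ;; Add rQ2 rQ2 rOne ;; Read rS rQ2 ;;
    Fetch rLa rA1 rY ;; If rS Skip (Sub rLa rK rLa) ;;
    Add rPos rPos rLen ;; Add rPos rPos rLen ;;
    Sub rQ2 rPos rOne ;; Read rY rQ2 ;; Read rS rPos ;;
    Fetch rLb rA1 rY ;; If rS Skip (Sub rLb rK rLb) ;;
    Sub rX rK rLa ;; Add rV rLb rZero ;; arc ;;
    Sub rX rK rLb ;; Add rV rLa rZero ;; arc)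
   (Const rBad 1) ;;
  Add rPos rPos rOne ;; Sub rC rC rOne.

Lemma clause_body_ok n d tau W L s0 s es A b (c : clause n) (Q : state -> nat -> Prop) k :
  consts n d tau W L s0 -> build_inv n W L s0 s es A b ->
  at_ (mem s0) (reg s rPos) (encode_clause c) ->
  reg s rPos + size (encode_clause c) <= W ->
  (forall s' k', k <= k' -> build_inv n W L s0 s' (clause_arcs A es c) A (b || nilp c) ->
     reg s' rPos = reg s rPos + size (encode_clause c) ->
     reg s' rC = reg s rC - 1 -> reg s' rI = reg s rI -> reg s' rQ = reg s rQ ->
     Q s' k') ->
  wp clause_body Q s (50 + k).
Proof.
move=> c0 I cp pW post.
have [ks km R fe hA vA wf bad] := I.
have csE := constsE c0 ks.
have cs := consts_keeps c0 ks.
have {cp} cp : at_ (mem s) (reg s rPos) (encode_clause c).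
  by apply: at_frame cp _ km; nlia.
have [/= len ats] := (at_cons _ _ _ _).1 cp.
rewrite /clause_body; start; branch csE; last first.
  rewrite len => sz; run csE.
  have c0' : nilp c by rewrite /nilp sz.
  apply: post; simp; rewrite ?csE //.
  - by nlia.
  - rewrite (_ : clause_arcs A es c = es); last by case: (bseqval c) c0'.
    split; simp => //; first exact: keeps_over.
    by rewrite c0' orbT.
  - by rewrite /encode_clause /encode_list (nilP c0').
move=> ne; have {ne} [l [c' cE]] : exists l c', bseqval c = l :: c'.
  by move: ne; rewrite len; case: (bseqval c) => // l c' _; exists l, c'.
set u := last l c'; set p := reg s rPos.
have [p1 p2 p3 p4 pE] : [/\ mem s p.+1 = l.1, mem s p.+2 = l.2,
     mem s (p + size c + size c - 1) = u.1, mem s (p + size c + size c) = u.2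
   & size (encode_clause c) = 1 + size c + size c].
  have := size_bseq c; move: ats; rewrite /u /encode_clause /encode_list !cE -/p.
  case: {cE u} c' => [|l2 [|//]] /= /at_cons[h1 /at_cons[h2 h3]] _.
    by rewrite !addnS !addn0 subn1.
  have [h4 /at_cons[h5 _]] := (at_cons _ _ _ _).1 h3.
  by rewrite !addnS !addn0 subn1.
have code_ok (v : literal n) :
    (if v.2 == 0 :> nat then n.*2.+1 - mem s ((W + L).+1 + v.1) else mem s ((W + L).+1 + v.1))
    = code A v.
  have -> : (W + L).+1 + v.1 = W + L + v.1.+1 by lia.
  by rewrite hA ?ltnS ?leq0n ?ltn_ord // /code; case: v.2.
run (csE, addn1); rewrite -/p p1 p2.
apply: wp_cond_sub; lazy [get set eqn]; rewrite ?csE (code_ok l).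
run (csE, addn1, len); rewrite -/p.
rewrite p3 p4; apply: wp_cond_sub; lazy [get set eqn]; rewrite ?csE (code_ok u).
run (csE, addn0).
have la := lit_code l vA; have lb := lit_code u vA.
have -> : 29 + k = 10 + (19 + k) by lia.
set s1 := over _ _ _; have k1 : keeps s0 s1 by exact: keeps_over.
apply: (arc_ok (es := es) (consts_keeps c0 k1)); rewrite /s1; simp => //; first exact: lit_neg.
move=> s2 sm2; simp => km2 R2 fe2.
have k2 : keeps s0 s2 by apply: keeps_trans k1 _; exact: same_keeps sm2.
have cs2E := constsE c0 k2.
have e r : r \notin [:: 20; 24; 26; 37] -> reg s2 r = reg s1 r := sm2 r.
have e35 : reg s2 35 = code A l by rewrite e // /s1; simp.
have e36 : reg s2 36 = code A u by rewrite e // /s1; simp.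
start; run (cs2E, e35, e36, addn0).
have -> : 17 + k = 10 + (7 + k) by lia.
set s3 := over _ _ _; have k3 : keeps s0 s3 by exact: keeps_over.
apply: (arc_ok (es := (neg n (code A l), code A u) :: es) (consts_keeps c0 k3)); rewrite /s3; simp => //; first exact: lit_neg.
move=> s4 sm4; simp => km4 R4 fe4.
have k4 : keeps s0 s4 by apply: keeps_trans k3 _; exact: same_keeps sm4.
have cs4E := constsE c0 k4.
have e4 r : r \notin [:: 20; 21; 22; 24; 26; 37] -> reg s4 r = reg s1 r.
  move=> h; rewrite sm4; last by apply: contra h; rewrite !inE => /or4P[] /eqP ->.
  rewrite /s3 reg_over /= !ifF ?e //; do ?[by apply: contraNF h => /eqnP ->].
  by apply: contra h; rewrite !inE => /or4P[] /eqP ->.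
start; run cs4E.
have mm a : a < W + L + n.*2.+1 -> mem s4 a = mem s a by move=> ha; rewrite km4 ?km2.
apply: post; simp.
- by nlia.
- split; simp => //.
  + exact: keeps_over.
  + by apply: keepm_trans km _ => a ha; apply: mm; nlia.
  + by rewrite /clause_arcs cE.
  + by move=> x xn; rewrite mm ?hA //; nlia.
  + exact: impl_graph_clause.
  + by rewrite e4 // /s1; simp; rewrite bad /nilp cE orbF.
- by rewrite e4 // /s1; simp; rewrite pE; nlia.
- by rewrite e4 // /s1; simp.
- by rewrite e4 // /s1; simp.
- by rewrite e4 // /s1; simp.
Qed.

Definition clause_loop : cmd := While rC clause_body.

Lemma clause_loop_ok n d tau W L s0 s es A b (phi : cnf2 n) (Q : state -> nat -> Prop) kr k :
  consts n d tau W L s0 -> build_inv n W L s0 s es A b ->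
  at_ (mem s0) (reg s rPos) (flatten (map (@encode_clause n) phi)) ->
  reg s rPos + size (flatten (map (@encode_clause n) phi)) <= W ->
  reg s rC = size phi ->
  kr + 51 * size phi + 1 <= k ->
  (forall s' k', kr <= k' ->
     build_inv n W L s0 s' (foldl (fun es (c : clause n) => clause_arcs A es c) es phi) A
       (b || has (fun c : clause n => nilp c) phi) ->
     reg s' rPos = reg s rPos + size (flatten (map (@encode_clause n) phi)) ->
     reg s' rI = reg s rI -> reg s' rQ = reg s rQ ->
     Q s' k') ->
  wp clause_loop Q s k.
Proof.
move=> c0 I ap pW eC kk post.
apply: (@wp_while _ _ (fun s1 k1 => exists es1 b1 phi1,
  [/\ build_inv n W L s0 s1 es1 A b1 /\ b1 || has (fun c : clause n => nilp c) phi1 =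
        b || has (fun c : clause n => nilp c) phi,
      foldl (fun es (c : clause n) => clause_arcs A es c) es1 phi1 =
      foldl (fun es (c : clause n) => clause_arcs A es c) es phi,
      [/\ at_ (mem s0) (reg s1 rPos) (flatten (map (@encode_clause n) phi1)),
      reg s1 rPos + size (flatten (map (@encode_clause n) phi1)) =
      reg s rPos + size (flatten (map (@encode_clause n) phi)) & reg s1 rC = size phi1],
      reg s1 rI = reg s rI /\ reg s1 rQ = reg s rQ & kr + 51 * size phi1 + 1 <= k1])).
  by exists es, b, phi.
move=> s1 k1 [es1 [b1 [phi1 [[I1 eb] ee [ap1 pe eC1] [eI eQ] kk1]]]].
split; first by nlia.
rewrite eC1; case: phi1 => [|c phi1] in eb ee ap1 pe eC1 kk1 *.
  split=> // _; apply: post => //.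
  - by nlia.
  - by rewrite -ee -eb /= orbF.
  - by rewrite -pe /= addn0.
split=> // _.
have -> : k1 - 1 = 50 + (k1 - 51) by rewrite /= in kk1; nlia.
have [ap2 ap3] := (at_cat _ _ _ _).1 ap1.
have szE : size (flatten (map (@encode_clause n) (c :: phi1))) =
    size (encode_clause c) + size (flatten (map (@encode_clause n) phi1)).
  by rewrite -size_cat.
rewrite {}szE in pe.
apply: (clause_body_ok c0 I1 ap2); first by nlia.
move=> s2 k2 kk2 I2 eP eC2 eI2 eQ2; exists (clause_arcs A es1 c), (b1 || nilp c), phi1.
split=> //.
- by split=> //; rewrite -eb /= orbA.
- by split; rewrite ?eP -?pe // ?eC2 ?eC1 /=; nlia.
- by rewrite eI2 eQ2.
- by rewrite /= in kk1; nlia.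
Qed.

Definition toggle_loop : cmd :=
  While rJ
    (Read rY rQ ;; Fetch rS rA rY ;; Sub rS rK rS ;; Store rA rY rS ;;
     Add rQ rQ rOne ;; Sub rJ rJ rOne).

Lemma toggle_loop_ok n d tau W L s0 s es A b ds (Q : state -> nat -> Prop) kr k :
  consts n d tau W L s0 -> build_inv n W L s0 s es A b ->
  at_ (mem s0) (reg s rQ) ds -> all (leq^~ n) ds ->
  reg s rQ + size ds <= W + L -> reg s rJ = size ds ->
  kr + 9 * size ds + 1 <= k ->
  (forall s' k', kr <= k' -> build_inv n W L s0 s' es (foldl (toggle n) A ds) b ->
     reg s' rQ = reg s rQ + size ds ->
     reg s' rI = reg s rI -> reg s' rPos = reg s rPos ->
     Q s' k') ->
  wp toggle_loop Q s k.
Proof.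
move=> c0 I ap dn qW eJ kk post.
apply: (@wp_while _ _ (fun s1 k1 => exists A1 ds1,
  [/\ build_inv n W L s0 s1 es A1 b, foldl (toggle n) A1 ds1 = foldl (toggle n) A ds,
      [/\ at_ (mem s0) (reg s1 rQ) ds1, all (leq^~ n) ds1,
          reg s1 rQ + size ds1 = reg s rQ + size ds & reg s1 rJ = size ds1],
      reg s1 rI = reg s rI /\ reg s1 rPos = reg s rPos & kr + 9 * size ds1 + 1 <= k1])).
  by exists A, ds.
move=> s1 k1 [A1 [ds1 [I1 eA [ap1 dn1 eQ eJ1] [eI eP] kk1]]].
split; first by nlia.
rewrite eJ1; case: ds1 => [|x ds1] in eA ap1 dn1 eQ eJ1 kk1 *.
  split=> // _; apply: post => //.
  - by nlia.
  - by rewrite -eA.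
  - by rewrite -eQ /= addn0.
split=> // _.
have -> : k1 - 1 = 8 + (k1 - 9) by rewrite /= in kk1; nlia.
have [ap2 ap3] := (at_cons _ _ _ _).1 ap1.
have /= /andP[xn dn2] := dn1.
have [ks km R fe hA vA wf bad] := I1.
have csE := constsE c0 ks.
have ex : mem s1 (reg s1 30) = x by rewrite km ?ap2 //; rewrite /= in eQ; nlia.
start; run (csE, ex, addn1).
exists (toggle n A1 x), ds1; split; simp => //.
- have mm a : a <> W + L + x -> upd (mem s1) (W + L + x)
      (n.*2.+1 - mem s1 (W + L + x)) a = mem s1 a by move=> ?; rewrite upd_neq.
  split; simp => //.
  + exact: keeps_over.
  + by apply: keepm_upd => //; nlia.
  + case: R => hT hP hCT hCP hs hp; split=> //.
    * by move=> l ll; rewrite mm ?hT //; unfold lit in ll; nlia.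
    * by move=> l ll; rewrite mm ?hP //; unfold lit in ll; nlia.
    * move=> l ll; rewrite mm; last by unfold lit in ll; nlia.
      by apply: chain_frame (leqnn _) (hCT l ll) => a aa; apply: mm; nlia.
    * move=> l ll; rewrite mm; last by unfold lit in ll; nlia.
      by apply: chain_frame (leqnn _) (hCP l ll) => a aa; apply: mm; nlia.
  + move=> l ln; rewrite /toggle /put; case: eqP => [<-|lx].
      by rewrite updE hA.
    by rewrite mm ?hA //; nlia.
  + exact: lit_toggle.
- by split=> //; rewrite /= in eQ eJ1; nlia.
- by rewrite /= in kk1; nlia.
Qed.

Definition reset_loop : cmd :=
  While rI
    (Store rA rI rI ;; Store rCT rI rZero ;; Store rCP rI rZero ;; Store rT rI rZero ;;
     Store rP rI rZero ;; Sub rI rI rOne).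

(** The link arrays and the arc pool keep their old contents, as empty lists never look at them;
    hence the representation holds for every [hi]. *)
Lemma reset_loop_ok n d tau W L (Q : state -> nat -> Prop) kr s k :
  consts n d tau W L s -> reg s rI = n.*2 -> kr + 12 * n.*2 + 1 <= k ->
  (forall s' k', kr <= k' -> keeps s s' -> keepm (W + L) (mem s) (mem s') ->
     (forall hi, graph_rep n (W + L) hi (mem s') (fun=> false) (fun=> false)
             (adj [::]) (adj [::]) [::] 0 [::] 0) ->
     (forall l, 0 < l <= n -> mem s' (W + L + l) = l) -> Q s' k') ->
  wp reset_loop Q s k.
Proof.
move=> c0 iE kk post.
apply: (@wp_while _ _ (fun s1 k1 => [/\ keeps s s1 /\ keepm (W + L) (mem s) (mem s1),
  reg s1 rI <= n.*2, forall l, reg s1 rI < l <= n.*2 ->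
    [/\ mem s1 (W + L + l) = l, mem s1 (W + L + n.*2.+1 + l) = 0,
        mem s1 (W + L + 2 * n.*2.+1 + l) = 0, mem s1 (W + L + 3 * n.*2.+1 + l) = 0
      & mem s1 (W + L + 4 * n.*2.+1 + l) = 0]
  & kr + 12 * reg s1 rI + 1 <= k1])).
  by split; rewrite ?iE // => l; nlia.
move=> s1 k1 [[ks km] i2 h kk1]; split; first by nlia.
split=> i0.
  apply: post => //; first by nlia.
    by move=> hi; split=> // l ll; have [|h1 h2 h3 h4 h5] := h l;
      rewrite ?h2 ?h3 ?h4 ?h5 //; unfold lit in ll; nlia.
  by move=> l ln; have [|-> //] := h l; nlia.
have csE := constsE c0 ks.
have -> : k1 - 1 = 11 + (k1 - 12) by nlia.
start; run csE; split; simp.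
- by split; [exact: keeps_over | do ?[apply: keepm_upd; first by nlia]].
- by nlia.
- move=> l ll; have [->|li] := l =P reg s1 31.
    by split; repeat first [rewrite updE | rewrite upd_neq; last by nlia].
  by have [|h1 h2 h3 h4 h5] := h l; [nlia|]; split; rewrite !upd_neq //; nlia.
- by nlia.
Qed.

Definition stage_body : cmd :=
  Add rJ rD rZero ;; toggle_loop ;; Read rC rPos ;; Add rPos rPos rOne ;;
  clause_loop ;; Sub rI rI rOne.

Definition build : cmd :=
  Add rI rN2 rZero ;; reset_loop ;; Const rPos 3 ;; Add rQ rDig rZero ;;
  Add rFe rE rZero ;; Const rBad 0 ;; Add rI rTau rZero ;; While rI stage_body.

Definition has_empty n (phis : seq (cnf2 n)) : bool :=
  has (fun phi : cnf2 n => has (fun c : clause n => nilp c) phi) phis.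

Lemma build_inv_reg n W L s0 s es A b al :
  all (fun r => (20 <= r) && (r != rFe) && (r != rBad)) [seq x.1 | x <- al] ->
  build_inv n W L s0 s es A b -> build_inv n W L s0 (over s al (mem s)) es A b.
Proof.
move=> h [h1 h2 h3 h4 h5 h6 h7 h8].
have same_al r : (r == 37) || (r == 28) -> reg (over s al (mem s)) r = reg s r.
  move=> hr; rewrite reg_over; elim: al h => //= -[a v] al IH /= /andP[ha /IH ->].
  rewrite -[eqn _ _]/(r == a) ifF //; apply: contraTF hr => /eqP ->.
  by case/andP: ha => /andP[_ /negbTE ->] /negbTE ->.
split; rewrite ?mem_over ?same_al //; apply: keeps_over => //.
by apply: sub_all h => r /andP[/andP[]].
Qed.

Lemma build_ok n d tau W L (phis : seq (cnf2 n)) ds (Q : state -> nat -> Prop) kr s k :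
  consts n d tau W L s -> size phis = tau ->
  at_ (mem s) 3 (flatten (map (@encode_cnf n) phis)) ->
  3 + size (flatten (map (@encode_cnf n) phis)) = W ->
  at_ (mem s) W ds -> size ds = tau * d -> L = tau * d -> all (leq^~ n) ds ->
  kr + 24 * n + 10 + tau * (9 * d + 10) + 51 * size (flatten phis) <= k ->
  (forall s' k', kr <= k' -> keeps s s' -> keepm (W + L) (mem s) (mem s') ->
     (let es := arcs d id [::] phis ds in
      impl_graph n es /\
      graph_rep n (W + L) (reg s' rFe) (mem s') (fun=> false) (fun=> false)
             (adj es) (adj es) [::] 0 [::] 0) ->
     (reg s' rBad <> 0 <-> has_empty phis) -> Q s' k') ->
  wp build Q s k.
Proof.
move=> c0 sp ap pW ad sd LE dn kk post; have csE := constsE c0 (keeps_refl s).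
have -> : k = 1 + (k - 1) by nlia.
rewrite /build; start; run (csE, addn0).
set s1 := over _ _ _; have k1 : keeps s s1 by exact: keeps_over.
apply: (reset_loop_ok (kr := kr + 7 + tau * (9 * d + 10) + 51 * size (flatten phis))
  (consts_keeps c0 k1)); rewrite /s1; simp => //; first by nlia.
move=> s2 k2 kk2 ks2; simp => km2 R2 A2.
have ks2' := keeps_trans k1 ks2.
have cs2E := constsE c0 ks2'.
have -> : k2 = 5 + (k2 - 5) by nlia.
start; run (cs2E, addn0).
set s3 := over _ _ _.
have I3 : build_inv n W L s s3 [::] id false.
  split; rewrite /s3; simp => //; first exact: keeps_over.
  by move=> l ln; rewrite /lit /=; nlia.
(* Invariant: running [arcs] on the remaining stages and digits from the current accumulators gives
   the arcs of the whole input. *)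
apply: (@wp_while _ _ (fun s4 k4 => exists es4 A4 b4 phis4 ds4,
  [/\ build_inv n W L s s4 es4 A4 b4,
      arcs d A4 es4 phis4 ds4 = arcs d id [::] phis ds /\
      b4 || has_empty phis4 = has_empty phis,
      [/\ reg s4 rI = size phis4, at_ (mem s) (reg s4 rPos) (flatten (map (@encode_cnf n) phis4))
        & reg s4 rPos + size (flatten (map (@encode_cnf n) phis4)) = W],
      [/\ at_ (mem s) (reg s4 rQ) ds4, size ds4 = size phis4 * d, all (leq^~ n) ds4
        & reg s4 rQ + size ds4 = W + L]
    & kr + 1 + size phis4 * (9 * d + 10) + 51 * size (flatten phis4) <= k4])).
  exists [::], id, false, phis, ds; split; rewrite // /s3; simp.
  - by split=> //; rewrite ?sp // sd LE.
  - by rewrite sp; nlia.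
move=> s4 k4 [es4 [A4 [b4 [phis4 [ds4 [I4 [ea eb] [eI ap4 pe] [ad4 sd4 dn4 qe] kk4]]]]]].
split; first by nlia.
rewrite eI; case: phis4 => [|phi phis4] in ea eb eI ap4 pe sd4 kk4 *.
  split=> // _; have [h1 h2 h3 h4 h5 h6 h7 h8] := I4.
  apply: post => //; first by nlia.
    by rewrite -ea.
  by rewrite h8 -eb /= orbF.
split=> // _.
have szE : size (flatten (map (@encode_cnf n) (phi :: phis4))) =
    (size (flatten (map (@encode_clause n) phi))).+1 +
    size (flatten (map (@encode_cnf n) phis4)).
  exact: (size_cat (encode_cnf phi)).
rewrite {}szE in pe.
have [/at_cons[p1 p2] p3] := (at_cat _ _ _ _).1 ap4.
have sE : size (flatten (phi :: phis4)) = size phi + size (flatten phis4) by rewrite -size_cat.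
rewrite {}sE /= in kk4.
have dE : ds4 = take d ds4 ++ drop d ds4 by rewrite cat_take_drop.
have szd : size (take d ds4) = d by rewrite size_takel // sd4 /= mulSn; lia.
have [k4' -> kk4'] : exists2 k', k4 - 1 = 1 + k' & kr + size phis4 * (9 * d + 10) +
     51 * (size phi + size (flatten phis4)) + 9 * d + 9 <= k'.
  by exists (k4 - 2); rewrite mulSn in kk4; nlia.
have cs4E := constsE c0 (bi_keeps I4).
rewrite /stage_body; start; run (cs4E, addn0).
set s5 := over _ _ _.
have I5 : build_inv n W L s s5 es4 A4 b4 by exact: build_inv_reg.
have [adt add] : at_ (mem s) (reg s4 30) (take d ds4) /\ at_ (mem s) (reg s4 30 + d) (drop d ds4).
  by rewrite -{2}szd; apply/at_cat; rewrite -dE.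
have /andP[dnt dnd] : all (leq^~ n) (take d ds4) && all (leq^~ n) (drop d ds4).
  by rewrite -all_cat -dE.
have szdd : size (drop d ds4) = size phis4 * d by rewrite size_drop sd4 /= mulSn; lia.
have sdd : size ds4 = d + size phis4 * d by rewrite sd4 /= mulSn.
apply: (toggle_loop_ok (kr := kr + size phis4 * (9 * d + 10) + 51 * (size phi + size (flatten phis4)) + 8) c0 I5 _ dnt);
  rewrite /s5; simp => //; [by nlia | by rewrite szd; nlia |].
move=> s6 k6 kk6 I6 eq6 ei6 ep6.
have cs6E := constsE c0 (bi_keeps I6).
have -> : k6 = 2 + (k6 - 2) by nlia.
have p6 : mem s6 (reg s4 29) = size phi.
  by rewrite (bi_keepm I6) ?p1 //; nlia.
start; run (cs6E, ep6, p6, addn1).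
set s7 := over _ _ _.
have I7 : build_inv n W L s s7 es4 (foldl (toggle n) A4 (take d ds4)) b4 by exact: build_inv_reg.
apply: (clause_loop_ok (phi := phi) (kr := kr + size phis4 * (9 * d + 10) + 51 * (size (flatten phis4)) + 4) c0 I7);
  rewrite /s7; simp => //; [by nlia | by nlia |].
move=> s8 k8 kk8 I8 ep8 ei8 eq8.
have cs8E := constsE c0 (bi_keeps I8).
have -> : k8 = 1 + (k8 - 1) by nlia.
start; run (cs8E).
exists (foldl (fun es (c : clause n) => clause_arcs (foldl (toggle n) A4 (take d ds4)) es c) es4 phi),
  (foldl (toggle n) A4 (take d ds4)), (b4 || has (fun c : clause n => nilp c) phi), phis4, (drop d ds4).
have eq8' : reg s8 30 = reg s4 30 + d by rewrite eq8 eq6 szd.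
have ep8' : reg s8 29 = reg s4 29 + (size (flatten (map (@encode_clause n) phi))).+1.
  by rewrite ep8 addSnnS.
split; simp.
- exact: build_inv_reg.
- by split=> //; rewrite -orbA.
- by split; rewrite ?ep8' // ?ei8 ?ei6 ?eI /=; nlia.
- by split; rewrite ?eq8' //; nlia.
- by nlia.
Qed.

Lemma size_arcs n d A es (phis : seq (cnf2 n)) ds :
  size (arcs d A es phis ds) <= size es + 2 * size (flatten phis).
Proof.
elim: phis A es ds => [|phi phis IH] A es ds /=; first by rewrite addn0.
apply: leq_trans (IH _ _ _) _; rewrite size_cat.
suff: forall A', size (foldl (fun es (c : clause n) => clause_arcs A' es c) es phi) <= size es + 2 * size phi.
  by move=> /(_ (foldl (toggle n) A (take d ds))); lia.
move=> A'; elim: phi es {IH} => [|c phi IH] es /=; first by rewrite addn0.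
apply: leq_trans (IH _) _.
have : size (clause_arcs A' es c) <= size es + 2 by case: (bseqval c) => //= *; lia.
lia.
Qed.

(** * Enumeration of the digit vectors *)

(** Least significant digit first. The program never computes this value; it measures the progress
    of the enumeration. *)
Fixpoint val_digits b (ds : seq nat) : nat :=
  if ds is x :: ds' then x + b * val_digits b ds' else 0.

Lemma val_digits_lt n ds : all (leq^~ n) ds -> val_digits n.+1 ds < n.+1 ^ size ds.
Proof.
elim: ds => //= x ds IH /andP[xn /IH h]; rewrite expnS.
by apply: leq_trans (_ : n.+1 * (val_digits n.+1 ds).+1 <= _); [rewrite mulnS; lia | rewrite leq_pmul2l].
Qed.

Lemma val_digits_inj n ds ds' :
  size ds = size ds' -> all (leq^~ n) ds -> all (leq^~ n) ds' ->
  val_digits n.+1 ds = val_digits n.+1 ds' -> ds = ds'.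
Proof.
elim: ds ds' => [|x ds IH] [|y ds'] //= [sz] /andP[xn dn] /andP[yn dn'] e.
have xy : x = y.
  have := congr1 (modn^~ n.+1) e; rewrite ![_ + n.+1 * _]addnC ![n.+1 * _]mulnC !modnMDl.
  by rewrite !modn_small.
subst y; congr (_ :: _); apply: IH => //.
by move/addnI: e => /eqP; rewrite eqn_pmul2l // => /eqP.
Qed.

Lemma val_digits_carry n j x r :
  val_digits n.+1 (nseq j 0 ++ x.+1 :: r) = (val_digits n.+1 (nseq j n ++ x :: r)).+1.
Proof. by elim: j => //= j ->; rewrite mulnS; lia. Qed.

Lemma val_digits_max n j ds :
  size ds = j -> all (leq^~ n) ds -> val_digits n.+1 ds <= val_digits n.+1 (nseq j n).
Proof.
elim: j ds => [|j IH] [|x ds] //= [sz] /andP[xn dn].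
by apply: leq_add => //; rewrite leq_pmul2l // IH.
Qed.

Lemma nseq_cat_cons (T : Type) j (x : T) r : nseq j x ++ x :: r = nseq j.+1 x ++ r.
Proof. by elim: j => //= j ->. Qed.

(** [rS2] is nonzero iff the digit is below n. Setting [rI] to 0 leaves the loop, and [rJ] tells a
    successful increment from an overflow. *)
Definition inc_body : cmd :=
  Read rS rQ ;; Sub rS2 rN rS ;;
  If rS2 (Add rS rS rOne ;; Write rQ rS ;; Const rJ 1 ;; Const rI 0)
         (Write rQ rZero ;; Add rQ rQ rOne ;; Sub rI rI rOne).

Definition inc : cmd :=
  Add rI rL rZero ;; Add rQ rDig rZero ;; Const rJ 0 ;; While rI inc_body.

Lemma at_upd m p s1 x y s2 :
  at_ m p (s1 ++ x :: s2) -> at_ (upd m (p + size s1) y) p (s1 ++ y :: s2).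
Proof.
move=> h i; rewrite size_cat /= nth_cat => ii.
have [->|ne] := i =P size s1; first by rewrite updE ltnn subnn.
rewrite upd_neq; last by lia.
rewrite h ?nth_cat ?size_cat //; case: ifP => // li.
by case e : (i - size s1) => [|z] //; lia.
Qed.

Lemma inc_ok n d tau W L ds (Q : state -> nat -> Prop) kr s k :
  consts n d tau W L s -> at_ (mem s) W ds -> size ds = L -> all (leq^~ n) ds ->
  kr + 9 * L + 4 <= k ->
  (forall s' k', kr <= k' -> keeps s s' -> keepm W (mem s) (mem s') ->
     (reg s' rJ = 0 -> ds = nseq L n) ->
     (reg s' rJ <> 0 -> exists ds', [/\ at_ (mem s') W ds', size ds' = L,
         all (leq^~ n) ds' & val_digits n.+1 ds' = (val_digits n.+1 ds).+1]) ->
     Q s' k') ->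
  wp inc Q s k.
Proof.
move=> c0 ad sd dn kk post; have csE := constsE c0 (keeps_refl s).
have -> : k = 3 + (k - 3) by nlia.
rewrite /inc; start; run (csE, addn0).
apply: (@wp_while _ _ (fun s1 k1 => [/\ keeps s s1, keepm W (mem s) (mem s1),
  kr + 9 * reg s1 rI + 1 <= k1,
  reg s1 rJ = 0 -> exists j r, [/\ ds = nseq j n ++ r, reg s1 rQ = W + j,
    reg s1 rI = size r & at_ (mem s1) W (nseq j 0 ++ r)]
  & reg s1 rJ <> 0 -> reg s1 rI = 0 /\ exists ds', [/\ at_ (mem s1) W ds', size ds' = L,
         all (leq^~ n) ds' & val_digits n.+1 ds' = (val_digits n.+1 ds).+1]])).
  split; simp => //; first exact: keeps_over.
  - by nlia.
  - by move=> _; exists 0, ds; rewrite addn0 sd.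
move=> s1 k1 [ks km kk1 h0 h1]; split; first by nlia.
split=> i0.
  apply: post => //; first by nlia.
  - move=> /h0[j [r [e _ ]]]; rewrite i0 => /esym/size0nil r0 _.
    by move: sd; rewrite e r0 cats0 size_nseq => ->.
  - by move=> J1; have [] := h1 J1.
have j0 : reg s1 rJ = 0.
  by have [//|J1] := reg s1 rJ =P 0; have [i1 _] := h1 J1; case: i0.
have [j [r [e eq ei am]]] := h0 j0.
case: r => [|x r] in e ei am; first by rewrite ei in i0.
have cs1E := constsE c0 ks.
have ex : mem s1 (W + j) = x.
  by have := am j; rewrite size_cat size_nseq nth_cat size_nseq ltnn subnn /= => -> //; lia.
have jL : j + (size r).+1 = L by rewrite -sd e size_cat size_nseq.
have [xn rn] : x <= n /\ all (leq^~ n) r by move: dn; rewrite e all_cat /= => /and3P[].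
have -> : k1 - 1 = 8 + (k1 - 9) by nlia.
rewrite /inc_body; start; branch (cs1E, eq, ex).
  move=> nx; run (cs1E, eq, addn1); split; simp => //.
  - exact: keeps_over.
  - by apply: keepm_upd => //; nlia.
  - by nlia.
  - move=> _; split=> //; exists (nseq j 0 ++ x.+1 :: r); split.
    + by rewrite -{1}(size_nseq j 0); exact: at_upd am.
    + by rewrite size_cat size_nseq.
    + by rewrite all_cat /= rn all_nseq /= orbT /= andbT; nlia.
    + by rewrite e val_digits_carry.
move=> nx; run (cs1E, eq, addn1); split; simp => //.
- exact: keeps_over.
- by apply: keepm_upd => //; nlia.
- by nlia.
- move=> _; exists j.+1, r; split=> //.
  + rewrite e (_ : x = n); last by nlia.
    by rewrite nseq_cat_cons.
  + by rewrite addnS.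
  + by rewrite ei /=; nlia.
  + have := at_upd (y := 0) am; rewrite size_nseq.
    by rewrite nseq_cat_cons.
Qed.

(** * The algorithm *)

Definition good n d (phis : seq (cnf2 n)) (ds : seq nat) : Prop :=
  ~~ has_empty phis /\ exists g, satg n (arcs d id [::] phis ds) g.

Definition main_loop : cmd :=
  While rGo (build ;; solve ;;
    If rBad (inc ;; Add rGo rJ rZero) (Const rAns 1 ;; Const rGo 0)).

Lemma consts_over n d tau W L s al m :
  all (fun r => (r == 0) || (18 < r)) [seq x.1 | x <- al] ->
  consts n d tau W L s -> consts n d tau W L (over s al m).
Proof.
move=> h; have e r : 0 < r <= 18 -> reg (over s al m) r = reg s r.
  move=> hr; rewrite reg_over; elim: al h => //= -[a v] al IH /= /andP[ha /IH ->].
  by rewrite -[eqn _ _]/(r == a) ifF //; apply: contraTF ha => /eqP <-; lia.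
by case=> *; split; rewrite e.
Qed.

(** [C] pays for one digit vector. The invariant keeps [C] credits for each value from that of the
    current vector upwards, and asserts that all vectors of smaller value have failed. *)
Lemma main_loop_ok n d tau W L (phis : seq (cnf2 n)) (Q : state -> nat -> Prop) kr s k :
  let C := 300 * (n + 1) + tau * (18 * d + 10) + 500 * size (flatten phis) in
  consts n d tau W L s -> size phis = tau -> L = tau * d ->
  at_ (mem s) 3 (flatten (map (@encode_cnf n) phis)) ->
  3 + size (flatten (map (@encode_cnf n) phis)) = W ->
  at_ (mem s) W (nseq L 0) -> reg s rGo = 1 -> reg s rAns = 0 ->
  kr + n.+1 ^ L * C + 1 <= k ->
  (forall s' k', kr <= k' ->
     (reg s' rAns <> 0 <-> exists ds, [/\ size ds = L, all (leq^~ n) ds & good d phis ds]) ->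
     Q s' k') ->
  wp main_loop Q s k.
Proof.
move=> C; have CE : C = 300 * (n + 1) + tau * (18 * d + 10) + 500 * size (flatten phis) by [].
clearbody C => c0 sp LE ap pW ad go0 ans0 kk post.
apply: (@wp_while _ _ (fun s1 k1 => [/\ consts n d tau W L s1, keepm W (mem s) (mem s1),
  reg s1 rGo = 0 -> (reg s1 rAns <> 0 <->
    exists ds, [/\ size ds = L, all (leq^~ n) ds & good d phis ds]) /\ kr + 1 <= k1
  & reg s1 rGo <> 0 -> reg s1 rAns = 0 /\ exists ds, [/\ at_ (mem s1) W ds, size ds = L,
     all (leq^~ n) ds,
     forall v, size v = L -> all (leq^~ n) v -> val_digits n.+1 v < val_digits n.+1 ds ->
       ~ good d phis v
   & kr + (n.+1 ^ L - val_digits n.+1 ds) * C + 1 <= k1]])).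
  split=> //; first by rewrite go0.
  move=> _; split=> //; exists (nseq L 0).
  have v0 : val_digits n.+1 (nseq L 0) = 0 by elim: (L) => //= l ->; rewrite muln0.
  by split; rewrite ?size_nseq ?all_nseq ?leq0n ?orbT ?v0 ?subn0.
move=> s1 k1 [c1 km h0 h1].
have [go|go] := eqVneq (reg s1 rGo) 0.
  by have [a b] := h0 go; split; [lia | split=> // _; apply: post => //; lia].
have [ans1 [ds [ad1 sd1 dn1 neg1 kk1]]] := h1 (elimN eqP go).
have k1gt : 0 < k1 by apply: leq_trans kk1; rewrite addn1.
split=> //; split=> [e|_]; first by rewrite e in go.
have vlt := val_digits_lt dn1; rewrite sd1 in vlt.
have [k1' -> kk1'] : exists2 k', k1 - 1 = k' &
    kr + (n.+1 ^ L - (val_digits n.+1 ds).+1) * C + C <= k'.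
  exists (k1 - 1) => //; rewrite -addnA -mulSnr -subSn // subSS; nlia.
have apB : at_ (mem s1) 3 (flatten (map (@encode_cnf n) phis)).
  by apply: at_frame ap _ km; nlia.
set kr2 := kr + (n.+1 ^ L - (val_digits n.+1 ds).+1) * C in kk1' *.
have size_es := size_arcs d id [::] phis ds.
rewrite /= add0n in size_es.
have LC : C = 300 * (n + 1) + 18 * L + 10 * tau + 500 * size (flatten phis).
  by rewrite CE LE (mulnDr tau) mulnA (mulnC tau 18) -mulnA; lia.
have tE : tau * (9 * d + 10) = 9 * L + 10 * tau.
  by rewrite LE (mulnDr tau) mulnA (mulnC tau 9) -mulnA; lia.
apply: wp_seq.
apply: (build_ok (kr := kr2 + 200 * (2 * size (flatten phis) + n + 1) + 9 * L + 10)
  c1 sp apB pW ad1 _ LE dn1); first by rewrite sd1.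
  by rewrite tE; nlia.
move=> s2 k2 kk2 ks2 km2 [wf R] bad2.
have c2 := consts_keeps c1 ks2.
apply: wp_seq.
apply: (solve_ok (kr := kr2 + 9 * L + 10) c2 wf R); first by nlia.
move=> s3 k3 kk3 ks3 km3 bad3.
have c3 := consts_keeps c2 ks3.
have ks13 := keeps_trans ks2 ks3.
have km13 : keepm (W + L) (mem s1) (mem s3) by apply: keepm_trans km2 km3.
have kmW B m m' : B <= W + L -> keepm (W + L) m m' -> keepm B m m'.
  by move=> hB h a aB; apply: h; lia.
have ad3 : at_ (mem s3) W ds by apply: at_frame ad1 _ km13; rewrite sd1.
have km3' : keepm W (mem s) (mem s3).
  by apply: keepm_trans km _; apply: kmW km13; lia.
(* [bad2] and [bad3] describe rejection, that is, the absence of a model, so obtaining a model from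
   [rBad] being 0 is a classical step. *)
have goodE : reg s3 rBad = 0 <-> good d phis ds.
  split=> [b0|[ne ex]].
    have h : ~ (has_empty phis \/ ~ exists g, satg n (arcs d id [::] phis ds) g).
      by rewrite -bad2 -bad3 b0.
    by split; [apply/negP => e; apply: h; left | apply: NNPP => e; apply: h; right].
  apply/eqP; apply/negPn/negP => /eqP/bad3[/bad2 e|//].
  by rewrite e in ne.
have [k3' -> kk3'] : exists2 k', k3 = 3 + k' & kr2 + 9 * L + 6 <= k'.
  by exists (k3 - 3); nlia.
have krkr2 : kr <= kr2 by exact: leq_addr.
start; branch 0; last first.
  move=> b0; run 0; split; simp => //.
  - exact: consts_over.
  - move=> _; split; last by nlia.
    by split=> // _; exists ds; split=> //; apply/goodE.
move=> bn0; run 0.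
have c3' : consts n d tau W L (over s3 [::] (mem s3)) by exact: consts_over.
apply: (inc_ok (kr := kr2 + 2) c3' _ sd1 dn1) => //; first by nlia.
move=> s4 k4 kk4 ks4; simp => km4 j0 j1.
have -> : k4 = 1 + (k4 - 1) by nlia.
have cs4E := constsE c3' ks4.
start; run (cs4E, addn0).
(* By injectivity of [val_digits], [ds] is the only vector added to those already excluded. *)
have nv v : size v = L -> all (leq^~ n) v ->
    val_digits n.+1 v < (val_digits n.+1 ds).+1 -> ~ good d phis v.
  move=> sv vn; rewrite ltnS leq_eqVlt => /orP[/eqP vE|]; last exact: neg1.
  by rewrite (val_digits_inj _ vn dn1 vE) ?sv // => /goodE.
split; simp.
- exact: consts_over (consts_keeps c3' ks4).
- exact: keepm_trans km3' km4.
- move=> J0; split; last by nlia.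
  have ansE : reg s4 0 = 0 by rewrite ks4 // reg_over /= ks13.
  rewrite ansE; split=> // -[v [sv vn gv]]; exfalso; apply: nv gv => //.
  (* An overflow means that all digits of [ds] were n, the largest value, so no vector remains
     untested. *)
  by rewrite ltnS (j0 J0); exact: val_digits_max.
- move=> J1; split; first by rewrite ks4 // reg_over /= ks13.
  have [ds' [ad' sd' dn' vE]] := j1 J1; exists ds'; split=> //.
    by rewrite vE.
  by rewrite vE -/kr2; nlia.
Qed.

(** * Initialisation *)

Definition scan_clauses : cmd :=
  While rC (Read rLen rPos ;; Add rPos rPos rLen ;; Add rPos rPos rLen ;;
            Add rPos rPos rOne ;; Sub rC rC rOne).

(** Multiplication is not an instruction, so tau d is accumulated stage by stage; the same walk
    finds the end of the input, where the counter is placed. *)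
Definition scan : cmd :=
  While rI (Add rL rL rD ;; Read rC rPos ;; Add rPos rPos rOne ;; scan_clauses ;;
            Sub rI rI rOne).

Lemma size_encode_clause n (c : clause n) : size (encode_clause c) = 1 + 2 * size c.
Proof.
rewrite /encode_clause /= size_flatten /shape -map_comp add1n; congr _.+1.
by elim: (bseqval c) => //= l s ->; lia.
Qed.

Lemma scan_clauses_ok n (phi : cnf2 n) (Q : state -> nat -> Prop) kr s k :
  reg s rOne = 1 -> reg s rC = size phi ->
  at_ (mem s) (reg s rPos) (flatten (map (@encode_clause n) phi)) ->
  kr + 6 * size phi + 1 <= k ->
  (forall s' k', kr <= k' -> same [:: rPos; rLen; rC] s s' -> mem s' = mem s ->
     reg s' rPos = reg s rPos + size (flatten (map (@encode_clause n) phi)) -> Q s' k') ->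
  wp scan_clauses Q s k.
Proof.
move=> one eC ap kk post.
apply: (@wp_while _ _ (fun s1 k1 => exists phi1 : cnf2 n, [/\ same [:: rPos; rLen; rC] s s1,
  mem s1 = mem s, reg s1 rC = size phi1 /\ kr + 6 * size phi1 + 1 <= k1,
  reg s1 rPos + size (flatten (map (@encode_clause n) phi1)) =
  reg s rPos + size (flatten (map (@encode_clause n) phi))
  & at_ (mem s) (reg s1 rPos) (flatten (map (@encode_clause n) phi1))])).
  by exists phi.
move=> s1 k1 [phi1 [sm em [eC1 kk1] ep ap1]]; split; first by nlia.
rewrite eC1; case: phi1 => [|c phi1] in eC1 kk1 ep ap1 *.
  split=> // _; apply: post => //; first by nlia.
  by rewrite -ep /= addn0.
split=> // _; have -> : k1 - 1 = 5 + (k1 - 6) by rewrite /= in kk1; nlia.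
have [ap2 ap3] := (at_cat _ _ _ _).1 ap1.
have szE : size (flatten (map (@encode_clause n) (c :: phi1))) =
    1 + 2 * size c + size (flatten (map (@encode_clause n) phi1)).
  by rewrite -size_encode_clause; exact: (size_cat (encode_clause c)).
rewrite {}szE in ep; rewrite size_encode_clause in ap3.
have e1 : reg s1 1 = 1 by rewrite sm.
have ec : mem s1 (reg s1 29) = size c by rewrite em; have [] := (at_cons _ _ _ _).1 ap2.
start; run (e1, ec); exists phi1; split; simp => //.
- exact: same_over.
- by rewrite eC1 /= in kk1 *; nlia.
- by nlia.
- by have -> : reg s1 29 + size c + size c + 1 = reg s1 29 + (1 + 2 * size c) by nlia.
Qed.

Lemma scan_ok n d (phis : seq (cnf2 n)) (Q : state -> nat -> Prop) kr s k :
  reg s rOne = 1 -> reg s rD = d -> reg s rL = 0 -> reg s rI = size phis ->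
  at_ (mem s) (reg s rPos) (flatten (map (@encode_cnf n) phis)) ->
  kr + 7 * size phis + 6 * size (flatten phis) + 1 <= k ->
  (forall s' k', kr <= k' -> same [:: rL; rPos; rI; rC; rLen] s s' -> mem s' = mem s ->
     reg s' rPos = reg s rPos + size (flatten (map (@encode_cnf n) phis)) ->
     reg s' rL = size phis * d -> Q s' k') ->
  wp scan Q s k.
Proof.
move=> one eD eL eI ap kk post.
apply: (@wp_while _ _ (fun s1 k1 => exists phis1 : seq (cnf2 n),
  [/\ same [:: rL; rPos; rI; rC; rLen] s s1, mem s1 = mem s,
  [/\ reg s1 rI = size phis1, reg s1 rL + size phis1 * d = size phis * d
    & kr + 7 * size phis1 + 6 * size (flatten phis1) + 1 <= k1],
  reg s1 rPos + size (flatten (map (@encode_cnf n) phis1)) =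
  reg s rPos + size (flatten (map (@encode_cnf n) phis))
  & at_ (mem s) (reg s1 rPos) (flatten (map (@encode_cnf n) phis1))])).
  by exists phis; rewrite eL.
move=> s1 k1 [phis1 [sm em [eI1 eL1 kk1] ep ap1]]; split; first by nlia.
rewrite eI1; case: phis1 => [|phi phis1] in eI1 eL1 kk1 ep ap1 *.
  split=> // _; apply: post => //; first by nlia.
    by rewrite -ep /= addn0.
  by rewrite -eL1 addn0.
split=> // _.
have [/at_cons[ap2 ap3] ap4] := (at_cat _ _ _ _).1 ap1.
have szE : size (flatten (map (@encode_cnf n) (phi :: phis1))) =
    (size (flatten (map (@encode_clause n) phi))).+1 +
    size (flatten (map (@encode_cnf n) phis1)).
  exact: (size_cat (encode_cnf phi)).
rewrite {}szE in ep.
have sE : size (flatten (phi :: phis1)) = size phi + size (flatten phis1) by rewrite -size_cat.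
rewrite {}sE /= in kk1.
rewrite /= mulSn in eL1.
have e1 : reg s1 1 = 1 by rewrite sm.
have e3 : reg s1 3 = d by rewrite sm.
have ec : mem s1 (reg s1 29) = size phi by rewrite em.
have -> : k1 - 1 = 3 + (k1 - 4) by nlia.
start; run (e1, e3, ec, addn1).
apply: (scan_clauses_ok (phi := phi) (kr := kr + 7 * size phis1 + 6 * size (flatten phis1) + 2));
  simp => //; [by rewrite em | by nlia |].
move=> s2 k2 kk2 sm2; simp => em2 ep2.
have sm2' : same [:: rL; rPos; rI; rC; rLen] s s2.
  move=> r hr; rewrite sm2; last by apply: contra hr; rewrite !inE => /or3P[] ->; rewrite ?orbT.
  by move: r hr; apply: same_over.
have -> : k2 = 1 + (k2 - 1) by nlia.
have e21 : reg s2 1 = 1 by rewrite sm2'.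
have e2i : reg s2 31 = reg s1 31 by rewrite sm2 //; simp.
have e2l : reg s2 17 = reg s1 17 + d by rewrite sm2 //; simp.
start; run (e21, e2i, eI1).
exists phis1; split; simp => //.
- exact: same_over.
- by rewrite em2.
- by split; rewrite ?e2l /=; nlia.
- by rewrite ep2; nlia.
- by rewrite ep2 addSnnS.
Qed.

(** With truncated subtraction, d - (d - n) is min(d, n). *)
Definition init : cmd :=
  Const rOne 1 ;; Const rZero 0 ;; Read rN rZero ;; Read rD rOne ;;
  Sub rS rD rN ;; Sub rD rD rS ;; Const rS 2 ;; Read rTau rS ;;
  Add rN2 rN rN ;; Add rK rN2 rOne ;; Const rL 0 ;; Const rPos 3 ;; Add rI rTau rZero ;;
  scan ;;
  Add rDig rPos rZero ;; Add rA rPos rL ;; Add rA1 rA rOne ;;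
  Add rCT rA rK ;; Add rCP rCT rK ;; Add rT rCP rK ;; Add rP rT rK ;;
  Add rPAR rP rK ;; Add rPL rPAR rK ;; Add rE rPL rK ;; Const rGo 1.

Lemma init_ok n d0 (phis : seq (cnf2 n)) (Q : state -> nat -> Prop) kr s k :
  let w := [:: n, d0 & encode_list (@encode_cnf n) phis] in
  let d := minn d0 n in
  s = init_state w ->
  kr + 7 * size phis + 6 * size (flatten phis) + 30 <= k ->
  (forall s' k', kr <= k' ->
     consts n d (size phis) (size w) (size phis * d) s' -> mem s' = mem s ->
     reg s' rGo = 1 -> reg s' rAns = 0 -> Q s' k') ->
  wp init Q s k.
Proof.
move=> w d ew kk post.
have m0 : mem s 0 = n by rewrite ew.
have m1 : mem s 1 = d0 by rewrite ew.
have m2 : mem s 2 = size phis by rewrite ew.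
have dE : d0 - (d0 - n) = d by rewrite /d; lia.
have -> : k = 13 + (k - 13) by nlia.
rewrite /init; start; run (m0, m1, m2, dE, addn0, addnn, addn1).
apply: (scan_ok (d := d) (phis := phis) (kr := kr + 11)); simp => //; [| by nlia |].
  by move=> i _; rewrite ew.
move=> s1 k1 kk1 sm; simp => em; rewrite -[3 + _]/(size w) => ep eL.
have -> : k1 = 11 + (k1 - 11) by nlia.
have r1 : (reg s1 1 = 1) * (reg s1 18 = 0) * (reg s1 2 = n) * (reg s1 3 = d) *
    (reg s1 4 = n.*2.+1) * (reg s1 5 = n.*2) * (reg s1 16 = size phis) * (reg s1 0 = 0).
  by do !split; rewrite sm //; simp; rewrite ?ew.
start; run (r1, ep, eL, addn0).
apply: post => //; simp => //; first by nlia.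
  by split; simp; rewrite ?r1 ?eL; nlia.
by rewrite r1.
Qed.

Definition decide_ms2sat : cmd := init ;; main_loop.

Lemma decide_ok n d0 (phis : seq (cnf2 n)) kr :
  let w := [:: n, d0 & encode_list (@encode_cnf n) phis] in
  let d := minn d0 n in
  let tau := size phis in
  let C := 300 * (n + 1) + tau * (18 * d + 10) + 500 * size (flatten phis) in
  kr = 7 * tau + 6 * size (flatten phis) + n.+1 ^ (tau * d) * C + 31 ->
  exists t s', [/\ exec decide_ms2sat (init_state w) t s', t <= kr
    & reg s' rAns <> 0 <->
      exists ds, [/\ size ds = tau * d, all (leq^~ n) ds & good d phis ds]].
Proof.
move=> w d tau C krE.
suff [t [s' [h1 h2 h3]]] : wp decide_ms2sat (fun s' _ => reg s' rAns <> 0 <->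
      exists ds, [/\ size ds = tau * d, all (leq^~ n) ds & good d phis ds]) (init_state w) kr.
  by exists t, s'.
apply: wp_seq; apply: (@init_ok n d0 phis _ (n.+1 ^ (tau * d) * C + 1)) => //.
  by rewrite krE /tau; lia.
move=> s k hk c em go ans; rewrite -/d -/w -/tau in c.
apply: (main_loop_ok (kr := 0) c) => //.
- by rewrite em => i hi.
(* Memory beyond the input is zero, which already is the first digit vector. *)
- by rewrite em => i hi; rewrite nth_nseq if_same /= nth_default // leq_addr.
Qed.

(** * Digit vectors and multistage solutions *)

Definition hamming n (f f' : assignment n) : nat := #|[set x | f x != f' x]|.

(* f plays the role of an assignment preceding the first stage. *)
Fixpoint multistage_from n d (f : assignment n) (phis : seq (cnf2 n)) : Prop :=
  if phis is phi :: phis' then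
    exists f', [/\ hamming f f' <= d, sat_cnf f' phi & multistage_from d f' phis']
  else True.

Lemma multistage_fromP n d (f : assignment n) (phis : seq (cnf2 n)) :
  multistage_from d f phis <->
  exists F : nat -> assignment n,
    [/\ 0 < size phis -> hamming f (F 0) <= d,
        forall i, i < size phis -> sat_cnf (F i) (nth [::] phis i)
      & forall i, i.+1 < size phis -> hamming (F i) (F i.+1) <= d].
Proof.
elim: phis f => [|phi phis IH] f /=.
  by split=> // _; exists (fun=> f); split=> // i; rewrite ltn0.
split=> [[f' [ff' sf' /IH[F [h1 h2 h3]]]]|[F [h1 h2 h3]]].
  exists (fun i => if i is j.+1 then F j else f'); split=> // -[|i] //= hi.
  - exact: h2.
  - exact: h3.
exists (F 0); split; [exact: h1 | exact: (h2 0) |].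
apply/IH; exists (fun i => F i.+1); split=> [hs|i hi|i hi].
- exact: h3.
- exact: (h2 i.+1).
- exact: h3.
Qed.

Lemma hamming_refl n (f : assignment n) : hamming f f = 0.
Proof. by apply/eqP; rewrite cards_eq0; apply/eqP/setP => x; rewrite !inE eqxx. Qed.

Lemma multistage_2satE (I : ms2sat_input) :
  multistage_2sat I <-> exists f, multistage_from (maxchange I) f (stage I).
Proof.
have sz : size (stage I) = nstages I by rewrite size_tuple.
have nthE (i : 'I_(nstages I)) : tnth (stage I) i = nth [::] (stage I) i by exact: tnth_nth.
split=> [[f [h1 h2]]|[f /multistage_fromP[F [_ h2 h3]]]].
  pose i0 := Ordinal (nstages_gt0 I); pose F i := f (insubd i0 i).
  (* The assignment of the first stage serves as its own predecessor, at distance 0. *)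
  exists (F 0); apply/multistage_fromP; exists F; rewrite sz.
  split=> [_|i hi|i hi]; first by rewrite hamming_refl.
  - by rewrite -(insubdK i0 hi) -nthE; rewrite /F insubdK //; apply: h1.
  - by apply: h2; rewrite !insubdK // /in_mem /=; lia.
exists (fun i => F i); split=> [i|i j ij]; first by rewrite nthE; apply: h2; rewrite sz.
by rewrite ij; apply: h3; rewrite sz -ij.
Qed.

Lemma multistage_from_minn n d (f : assignment n) (phis : seq (cnf2 n)) :
  multistage_from (minn d n) f phis <-> multistage_from d f phis.
Proof.
elim: phis f => //= phi phis IH f.
have hm f' : (hamming f f' <= minn d n) = (hamming f f' <= d).
  by rewrite leq_min andbC -[X in _ <= X](card_ord n) max_card.
by split=> -[f' [h1 h2 /IH h3]]; exists f'; rewrite ?hm // -hm.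
Qed.

Definition read_off n (g : nat -> bool) (A : nat -> nat) : assignment n :=
  [ffun x : 'I_n => ev n g (A x.+1)].

Lemma ev_code n g A (l : literal n) :
  lit_valued n A -> ev n g (code A l) = sat_literal (read_off n g A) l.
Proof.
move=> vA; rewrite /code /sat_literal ffunE; case: l => x [] /=; first by case: ev.
by rewrite ev_neg ?vA ?ltn_ord //; case: ev.
Qed.

Lemma satg_clause n g A es (c : clause n) :
  lit_valued n A ->
  satg n (clause_arcs A es c) g <->
  satg n es g /\ (nilp c || sat_clause (read_off n g A) c).
Proof.
move=> vA; rewrite /sat_clause.
have : size c <= 2 by exact: size_bseq.
case: (bseqval c) => [|l c'] /= sz; first by split=> [|[]].
have la := lit_code l vA; have lb := lit_code (last l c') vA.
(* A clause has at most two literals, so its first and last ones are all of them. *)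
have -> : sat_literal (read_off n g A) l || has (sat_literal (read_off n g A)) c' =
    ev n g (code A l) || ev n g (code A (last l c')).
  rewrite !ev_code //; case: c' sz {lb} => [|l' [|//]] _ /=.
    by rewrite orbF orbb.
  by rewrite orbF.
split=> [h|[h ab] u v].
  split=> [u v uv|]; first by apply: h; rewrite !inE uv !orbT.
  have := h (neg n (code A l)) (code A (last l c')).
  by rewrite !inE eqxx orbT ev_neg // => /(_ isT); case: ev => //= ->.
rewrite !inE => /or3P[/eqP[-> ->]|/eqP[-> ->]|/h //]; rewrite ev_neg // => /negbTE e.
  by move: ab; rewrite e orbF.
by move: ab; rewrite e.
Qed.

Lemma satg_cnf n g A es (phi : cnf2 n) :
  lit_valued n A -> ~~ has (fun c : clause n => nilp c) phi ->
  satg n (foldl (fun es (c : clause n) => clause_arcs A es c) es phi) g <->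
  satg n es g /\ sat_cnf (read_off n g A) phi.
Proof.
move=> vA; elim: phi es => [|c phi IH] es /=; first by split=> [|[]].
rewrite negb_or => /andP[/negbTE nc nphi]; rewrite IH // satg_clause // nc /=.
by split=> [[[h1 h2] h3]|[h1 /andP[h2 h3]]]; rewrite ?h2.
Qed.

Lemma lit_toggles n A xs : lit_valued n A -> lit_valued n (foldl (toggle n) A xs).
Proof. by elim: xs A => //= x xs IH A vA; apply: IH; exact: lit_toggle. Qed.

Lemma toggles_notin n A xs y : y \notin xs -> foldl (toggle n) A xs y = A y.
Proof.
elim: xs A => //= x xs IH A; rewrite inE negb_or => /andP[yx ys].
by rewrite IH // /toggle put_neq.
Qed.

Lemma toggles_uniq n A xs y :
  uniq xs -> y \in xs -> foldl (toggle n) A xs y = neg n (A y).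
Proof.
elim: xs A => //= x xs IH A /andP[xs' u]; rewrite inE.
have [->|yx] /= := eqVneq y x; first by rewrite toggles_notin // /toggle putE.
by move=> ys; rewrite IH // /toggle put_neq.
Qed.

(** A variable whose value differs must occur in [xs]; equality may fail, since repeated flips
    cancel and digit 0 flips nothing. *)
Lemma hamming_toggles n g A xs :
  hamming (read_off n g A) (read_off n g (foldl (toggle n) A xs)) <= size xs.
Proof.
rewrite /hamming; set S := [set x | _].
rewrite cardE -(size_map (fun x : 'I_n => (x : nat).+1)); apply: uniq_leq_size.
  by rewrite map_inj_uniq ?enum_uniq // => x y [] /val_inj.
move=> y /mapP[x]; rewrite mem_enum inE !ffunE => h ->.
by apply: contraNT h => /toggles_notin ->.
Qed.

Lemma toggles_exist n g A (f : assignment n) d :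
  lit_valued n A -> hamming (read_off n g A) f <= d ->
  exists xs, [/\ size xs = d, all (leq^~ n) xs & read_off n g (foldl (toggle n) A xs) = f].
Proof.
rewrite /hamming; set S := [set x | _] => vA hd.
(* Zeros pad the list of flipped variables to length d. *)
exists (nseq (d - #|S|) 0 ++ [seq (nat_of_ord x).+1 | x <- enum S]); split.
- by rewrite size_cat size_nseq size_map -cardE subnK.
- by rewrite all_cat all_nseq leq0n orbT; apply/allP => _ /mapP[x _ ->].
apply/ffunP => x; rewrite ffunE foldl_cat.
have e0 : foldl (toggle n) A (nseq (d - #|S|) 0) x.+1 = A x.+1.
  by apply: toggles_notin; rewrite mem_nseq andbF.
have uS : uniq [seq (nat_of_ord x).+1 | x <- enum S].
  by rewrite map_inj_uniq ?enum_uniq // => y z [] /val_inj.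
have [xS|xS] := boolP (x \in S).
  rewrite toggles_uniq //; last by apply/mapP; exists x; rewrite ?mem_enum.
  rewrite e0 ev_neg ?vA ?ltn_ord //; move: xS; rewrite inE ffunE.
  by case: (f x); case: ev.
rewrite toggles_notin ?e0; first by apply/eqP; move: xS; rewrite inE ffunE negbK.
by apply/mapP => -[y]; rewrite mem_enum => yS [] /val_inj xy; rewrite xy yS in xS.
Qed.

Lemma arcs_sound n d g A es (phis : seq (cnf2 n)) ds :
  lit_valued n A -> ~~ has_empty phis -> size ds = size phis * d ->
  satg n (arcs d A es phis ds) g ->
  satg n es g /\ multistage_from d (read_off n g A) phis.
Proof.
elim: phis A es ds => //= phi phis IH A es ds vA; rewrite negb_or => /andP[ne nes].
rewrite mulSn => sd /IH[|//||].
- exact: lit_toggles.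
- by rewrite size_drop sd addKn.
rewrite satg_cnf //; last exact: lit_toggles.
move=> [h1 h2] h3; split=> //; exists (read_off n g (foldl (toggle n) A (take d ds))).
split=> //; apply: leq_trans (hamming_toggles _ _ _ _) _.
by rewrite size_takel // sd leq_addr.
Qed.

Lemma arcs_complete n d g A es (phis : seq (cnf2 n)) :
  lit_valued n A -> satg n es g -> multistage_from d (read_off n g A) phis ->
  ~~ has_empty phis /\
  exists ds, [/\ size ds = size phis * d, all (leq^~ n) ds & satg n (arcs d A es phis ds) g].
Proof.
elim: phis A es => [|phi phis IH] A es vA sg /=; first by split=> //; exists [::].
move=> [f' [hf' sf' ms]]; have [xs [sx xn fE]] := toggles_exist vA hf'.
rewrite -fE in sf' ms.
have ne : ~~ has (fun c : clause n => nilp c) phi.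
  apply/hasPn => c cphi; move/allP: sf' => /(_ _ cphi).
  by rewrite /sat_clause; case: (bseqval c).
have vA' := lit_toggles xs vA.
have sg' := (satg_cnf g es vA' ne).2 (conj sg sf').
have [nes [ds [sd dn h]]] := IH _ _ vA' sg' ms.
split; first by rewrite negb_or ne.
exists (xs ++ ds); split; first by rewrite size_cat sx sd mulSn.
  by rewrite all_cat xn.
by rewrite take_size_cat // drop_size_cat.
Qed.

Lemma lit_valued_id n : lit_valued n id.
Proof. by move=> l; rewrite /lit; lia. Qed.

Lemma multistage_digits (I : ms2sat_input) :
  multistage_2sat I <->
  exists ds, [/\ size ds = size (stage I) * minn (maxchange I) (nvars I),
    all (leq^~ (nvars I)) ds & good (minn (maxchange I) (nvars I)) (stage I) ds].
Proof.
rewrite multistage_2satE; split=> [[f /multistage_from_minn ms]|[ds [sd dn [ne [g sg]]]]].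
  (* [g] extends [f] to all numbers, the shift matching the codes, which start at 1. *)
  pose g l := oapp f false (insub l.-1).
  have fE : read_off (nvars I) g id = f.
    by apply/ffunP => x; rewrite ffunE /ev ltn_ord /g /= valK.
  rewrite -fE in ms.
  have [ne [ds [sd dn sg]]] := arcs_complete (es := [::]) (@lit_valued_id _) (fun u v => ltac:(by [])) ms.
  by exists ds; split=> //; split=> //; exists g.
exists (read_off _ g id); apply/multistage_from_minn.
by have [] := arcs_sound (@lit_valued_id _) ne sd sg.
Qed.

(** * Running time *)

Lemma size_flatten_le n (phis : seq (cnf2 n)) m :
  (forall phi : cnf2 n, phi \in phis -> size phi <= m) -> size (flatten phis) <= size phis * m.
Proof.
elim: phis => //= phi phis IH h; rewrite size_cat mulSn leq_add ?h ?mem_head //.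
by apply: IH => phi' hp; apply: h; rewrite inE hp orbT.
Qed.

(** The hypothesis admits n = 0 only if tau d = 0, when both sides are 1. For n > 0 the exponent
    [2 * tau * d] leaves a factor n^(tau d) to spare. *)
Lemma digit_vectors_le n tau d :
  0 < n ^ (2 * tau * d) -> n.+1 ^ (tau * minn d n) <= n ^ (2 * tau * d) * 2 ^ (tau * d).
Proof.
have [->|d0] := posnP d; first by rewrite min0n !muln0 !expn0.
have [->|t0] := posnP tau; first by rewrite !mul0n !expn0.
have [->|n0] := posnP n; first by rewrite exp0n ?muln_gt0 ?t0.
move=> _; apply: (@leq_trans ((2 * n) ^ (tau * d))).
  apply: (@leq_trans ((2 * n) ^ (tau * minn d n))); first by rewrite leq_exp2r; lia.
  by rewrite leq_pexp2l ?leq_pmul2l ?geq_minl //; lia.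
rewrite expnMn mulnC leq_pmul2r ?expn_gt0 // leq_pexp2l //.
by rewrite -mulnA leq_pmull.
Qed.

(** With T = tau (n + m) and [F] as in the proof, [f] is 2 F T while the left side is at most 1300 F
    T; the constant 2000 is generous. *)
Lemma running_time_le n tau d m S :
  0 < tau -> S <= tau * m ->
  let f := n ^ (2 * tau * d) * 2 ^ (tau * d + 1) * tau * (n + m) in
  0 < f ->
  7 * tau + 6 * S + n.+1 ^ (tau * minn d n) *
    (300 * (n + 1) + tau * (18 * minn d n + 10) + 500 * S) + 31 <= 2000 * f.
Proof.
move=> t0 Sm f; rewrite /f !muln_gt0 => /andP[/andP[/andP[p0 _] _] nm0].
have le := digit_vectors_le p0.
set N := n.+1 ^ _ in le *; set F := n ^ _ * _ in le.
have N0 : 0 < N by rewrite expn_gt0.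
have -> : n ^ (2 * tau * d) * 2 ^ (tau * d + 1) * tau * (n + m) = F * 2 * (tau * (n + m)).
  by rewrite addn1 expnS (mulnC 2 (2 ^ _)) !mulnA.
have tn : n <= tau * n by rewrite leq_pmull.
(* As [f] is nonzero, so is n + m, and constant overheads are absorbed by [tau * (n + m)]. *)
have tnm : tau <= tau * (n + m) by rewrite leq_pmulr.
have tm : tau * (n + m) = tau * n + tau * m by rewrite mulnDr.
(* Truncation pays here: a vector has at most tau n digits. *)
have tE : tau * (18 * minn d n + 10) <= 18 * (tau * n) + 10 * tau.
  by rewrite mulnDr mulnCA (mulnC tau 10) leq_add2r leq_mul2l leq_mul2l geq_minr !orbT.
have c1 : 300 * (n + 1) + tau * (18 * minn d n + 10) + 500 * S <= 1200 * (tau * (n + m)) by lia.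
have c2 : 7 * tau + 6 * S + 31 <= 100 * (tau * (n + m)) by lia.
move: c1 c2; set X := _ + 500 * S; set T := tau * (n + m) => c1 c2.
have h1 : N * X <= N * (1200 * T) by rewrite leq_pmul2l.
have h2 : 7 * tau + 6 * S + 31 <= N * (100 * T).
  by apply: leq_trans c2 _; rewrite leq_pmull.
have h3 : N * T <= F * T by rewrite leq_mul2r le orbT.
rewrite addnAC (mulnC F) -(mulnA 2).
rewrite mulnCA in h1; rewrite mulnCA in h2.
move: h1 h2 h3; move: (N * X) (N * T) (F * T) (7 * tau + 6 * S + 31) => a b c e; clear; lia.
Qed.

Theorem theorem6p1 :
  solvable_in_bigO encode_ms2sat multistage_2sat
    (fun I => nvars I ^ (2 * nstages I * maxchange I)
              * 2 ^ (nstages I * maxchange I + 1)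
              * nstages I * (nvars I + max_clauses I)).
Proof.
exists decide_ms2sat, 2000 => I.
have [t [s [ex tk ok]]] := decide_ok (d0 := maxchange I) (phis := stage I) (erefl _).
exists t, s; split=> //.
  by rewrite multistage_digits -ok /accepting; split=> /eqP.
move=> f0; apply: leq_trans tk _; rewrite !size_tuple.
apply: running_time_le => //; first exact: nstages_gt0.
rewrite -[X in X * _](size_tuple (stage I)); apply: size_flatten_le => phi /tnthP[i ->].
exact: (leq_bigmax i).
Qed.
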